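(* For every integer $k\ge 1$ there is a constant $\delta_k>0$ depending only on $k$ such that the following holds. Let $X$ be a GNPC space and let $f|_{\bar B(p_0,R)}$ be a half $(k,\delta)$-strainer map at $x\in\partial B(p_0,R)$ with base point $p_0$, where $0<\delta<\delta_k$. Then there exists an arbitrarily small contractible open neighborhood $V$ of $x$ in $\bar B(p_0,R)$ (i.e. every neighborhood of $x$ in $\bar B(p_0,R)$ contains such a $V$) such that $f|_V:V\to f(V)$ is a Hurewicz fibration with contractible fibers.
   Context: A shortest path is an isometric embedding of a closed interval into a metric space. A complete geodesic space $(Y,d)$ is BNPC if for any two constant-speed reparametrized shortest paths $\gamma,\eta:[0,1]\to Y$, the function $t\mapsto d(\gamma(t),\eta(t))$ is convex on $[0,1]$. A metric space is locally BNPC if every point has a neighborhood that is BNPC with respect to the ambient metric. A geodesic is a curve whose restriction to each sufficiently small subinterval is a shortest path; a space is locally geodesically complete if every geodesic $\gamma:[a,b]\to X$ extends to a geodesic on $[a-\varepsilon,b+\varepsilon]$ for some $\varepsilon>0$. A GNPC space is a separable, locally compact, locally geodesically complete, locally BNPC metric space. A tiny ball in a GNPC space is an open metric ball $B$ of some radius $r$ such that the concentric closed ball of radius $10r$ is a compact BNPC space; shortest paths between points of $B$ are unique. $\bar B(p,R)$ and $\partial B(p,R)=\{y:d(p,y)=R\}$ denote the closed ball and the metric sphere. Write $|ab|=d(a,b)$. Let $B$ be a tiny ball, $p\in B$, $q\in B\setminus\{p\}$, $x\in B\setminus\{q\}$, and let $x(t)$ be the unit-speed shortest path from $q$ to $x$.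 The angle viewed from $p$ at $q$ toward $x$ is $\angle pqx:=\lim_{t\to0}\tilde\angle pqx(t)$, where $\tilde\angle pqx(t)$ is the angle, at the vertex corresponding to $q$, of the Euclidean triangle with side lengths $|pq|$, $|px(t)|$, $|qx(t)|$ (the limit exists and $\cos\angle pqx=-\frac{d}{dt}\big|_{t=0^+}d(p,x(t))$). A point $p\in B$ is a $(1,\delta)$-strainer at $x\in B$ if there are $\bar p\in B$ (an opposite strainer for $p$ at $x$) and a neighborhood $U\subset B$ of $x$ with $p,\bar p\notin U$ such that $\angle py\bar p>\pi-\delta$ for all $y\in U$. Inductively, for $k\ge2$, $p_1,\dots,p_k\in B$ is a $(k,\delta)$-strainer at $x\in B$ if (1) $p_1,\dots,p_{k-1}$ is a $(k-1,\delta)$-strainer at $x$; (2) $p_k$ is a $(1,\delta)$-strainer at $x$; (3) there are an opposite strainer $\bar p_k$ for $p_k$ at $x$ and a neighborhood $U\subset B$ of $x$, not containing $p_1,\dots,p_k,\bar p_k$, such that $|\angle p_iyp_k-\pi/2|<\delta$ and $|\angle p_iy\bar p_k-\pi/2|<\delta$ for all $y\in U$ and $1\le i\le k-1$. For $k\ge1$, points $p_0,p_1,\dots,p_k\in B$ form an extended $(k,\delta)$-strainer at $x\in B$ with base point $p_0$ if (1) $p_1,\dots,p_k$ is a $(k,\delta)$-strainer at $x$, with opposite strainers $\bar p_1,\dots,\bar p_k$, and (2) there is a neighborhood $U\subset B$ of $x$ such that $|\angle p_0yp_i-\pi/2|<\delta$ and $|\angle p_0y\bar p_i-\pi/2|<\delta$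 for all $y\in U$ and $1\le i\le k$. Given such an extended strainer in a tiny ball $B\ni x$, put $f=(d(p_1,\cdot),\dots,d(p_k,\cdot))$ and $R:=|p_0x|$; the restriction $f|_{\bar B(p_0,R)}$ is called a half $(k,\delta)$-strainer map at $x$ with base point $p_0$. A Hurewicz fibration is a surjective continuous map with the homotopy lifting property with respect to all topological spaces. *)

(* Defs.v *)
From HB Require Import structures.
From mathcomp Require Import all_boot all_order all_algebra.
From mathcomp Require Import all_classical all_reals all_analysis.
Set Implicit Arguments.
Unset Strict Implicit.
Unset Printing Implicit Defensive.
Import Order.TTheory GRing.Theory Num.Theory.
Import numFieldNormedType.Exports.
Local Open Scope classical_set_scope.
Local Open Scope ring_scope.

Section topology.
Variable R : realType.

(* A homotopy is a function on T * R of which only the restriction to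
   T * [0, 1] matters; every homotopy defined on T * [0, 1] extends to such a
   function by clamping the time parameter. *)
Definition homotopy_continuous (S T : topologicalType) (H : S * R -> T) :=
  {within [set: S] `*` `[0, 1], continuous H}.

Definition contractible (T : topologicalType) : Prop :=
  exists (a : T) (H : T * R -> T),
    [/\ homotopy_continuous H,
        forall y, H (y, 0) = y &
        forall y, H (y, 1) = a].

Definition homotopy_lifting (E B : topologicalType) (f : E -> B) : Prop :=
  forall (Z : topologicalType) (h : Z -> E) (H : Z * R -> B),
    continuous h -> homotopy_continuous H ->
    (forall z, H (z, 0) = f (h z)) ->
    exists G : Z * R -> E,
      [/\ homotopy_continuous G,
          forall z, G (z, 0) = h z &
          forall z t, 0 <= t <= 1 -> f (G (z, t)) = H (z, t)].

Definition hurewicz_fibration (E B : topologicalType) (f : E -> B) : Prop :=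
  [/\ continuous f, (forall b, exists e, f e = b) & homotopy_lifting f].

End topology.

(* f restricted to V, as a map between the subspaces V and f(V). *)
Definition onto_image (S T : Type) (f : S -> T) (V : set S) (v : V) : f @` V :=
  SigSub (mem_set (imageP f (set_valP v))).

Section metric.
Variables (R : realType) (X : metricType R).
Implicit Types (p q x y : X) (B U Y : set X) (g h : R -> X).

Definition metric_cball p (r : R) : set X := [set y | mdist p y <= r].

Definition metric_sphere p (r : R) : set X := [set y | mdist p y = r].

(* Curves are functions on R of which only the restriction to [a, b]
   matters. *)
Definition shortest_path (a b : R) g : Prop :=
  {in `[a, b] &, forall s t, mdist (g s) (g t) = `|s - t|}.

Definition shortest_path_from_to x y g : Prop :=
  [/\ shortest_path 0 (mdist x y) g, g 0 = x & g (mdist x y) = y].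

Definition geodesic (a b : R) g : Prop :=
  {within `[a, b], continuous g} /\
  exists2 e : R, 0 < e &
    forall s t, a <= s -> s <= t -> t <= b -> t - s < e -> shortest_path s t g.

(* Subsets Y of X are regarded as metric spaces with the ambient metric. *)
Definition complete_subspace Y : Prop :=
  forall F : set_system X, ProperFilter F -> F Y -> cauchy F ->
    exists2 y, Y y & F --> y.

Definition geodesic_subspace Y : Prop :=
  forall x y, Y x -> Y y ->
    exists2 g, shortest_path_from_to x y g &
      {in `[0, mdist x y], forall t, Y (g t)}.

Definition constant_speed_shortest_path Y g : Prop :=
  (exists a b h, [/\ a <= b, shortest_path a b h &
    {in `[0, 1], forall t, g t = h (a + t * (b - a))}]) /\
  {in `[0, 1], forall t, Y (g t)}.

Definition bnpc Y : Prop :=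
  [/\ complete_subspace Y, geodesic_subspace Y &
      forall g h, constant_speed_shortest_path Y g ->
        constant_speed_shortest_path Y h ->
        @convex_function R R^o `[0, 1] (fun t => mdist (g t) (h t))].

Definition locally_bnpc : Prop := forall x, exists2 Y, nbhs x Y & bnpc Y.

Definition locally_geodesically_complete : Prop :=
  forall a b g, a < b -> geodesic a b g ->
    exists2 e : R, 0 < e &
      exists2 h, geodesic (a - e) (b + e) h &
        {in `[a, b], forall t, h t = g t}.

Definition gnpc : Prop :=
  [/\ (exists2 S : set X, countable S & dense S),
      locally_compact [set: X],
      locally_geodesically_complete &
      locally_bnpc].

Definition tiny_ball B : Prop :=
  exists c (r : R), [/\ 0 < r, B = ball c r,
    compact (metric_cball c (10 * r)) & bnpc (metric_cball c (10 * r))].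

(* By the law of cosines, the angle between the sides of lengths a and b of a
   Euclidean triangle whose third side has length c. *)
Definition euclidean_angle (a b c : R) : R :=
  acos ((a ^+ 2 + b ^+ 2 - c ^+ 2) / (2 * a * b)).

(* Only meaningful for p, x distinct from q; in a tiny ball the shortest path
   from q to x exists and is unique on [0, mdist q x]. *)
Definition some_shortest_path q x : R -> X :=
  xget (fun=> q) [set g | shortest_path_from_to q x g].

Definition angle p q x : R :=
  let g := some_shortest_path q x in
  lim (euclidean_angle (mdist p q) (mdist q (g t)) (mdist p (g t))
    @[t --> 0^'+]).

Definition opposite_strainer B (delta : R) p pbar x : Prop :=
  [/\ B p, B pbar & B x] /\
  exists U, [/\ nbhs x U, U `<=` B, ~ U p, ~ U pbar &
    forall y, U y -> pi - delta < angle p y pbar].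

Definition almost_orthogonal (delta : R) p q y : Prop :=
  `|angle p y q - pi / 2| < delta.

(* p_1, ..., p_k is a (k, delta)-strainer at x with opposite strainers
   pbar_1, ..., pbar_k; the family is indexed from 0, and for k = 1 the angle
   condition at the last point is empty. *)
Fixpoint strainer_with B (delta : R) x (k : nat) :
    ('I_k -> X) -> ('I_k -> X) -> Prop :=
  match k with
  | 0 => fun _ _ => True
  | k'.+1 => fun (p pbar : 'I_k'.+1 -> X) =>
      let p' := p \o widen_ord (leqnSn k') in
      [/\ strainer_with B delta x p' (pbar \o widen_ord (leqnSn k')),
          opposite_strainer B delta (p ord_max) (pbar ord_max) x &
          exists U, [/\ nbhs x U, U `<=` B, (forall i, ~ U (p i)),
            ~ U (pbar ord_max) &
            forall y, U y -> forall i : 'I_k',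
              almost_orthogonal delta (p' i) (p ord_max) y /\
              almost_orthogonal delta (p' i) (pbar ord_max) y]]
  end.

(* U avoids p0, p_i and pbar_i so that the angles at its points are defined. *)
Definition extended_strainer B (delta : R) x (k : nat) p0 (p : 'I_k -> X) :
    Prop :=
  B p0 /\
  exists2 pbar : 'I_k -> X, strainer_with B delta x p pbar &
    exists U, [/\ nbhs x U, U `<=` B, ~ U p0,
      (forall i, ~ U (p i) /\ ~ U (pbar i)) &
      forall y, U y -> forall i,
        almost_orthogonal delta p0 (p i) y /\
        almost_orthogonal delta p0 (pbar i) y].

(* The half strainer map is the restriction of f to metric_cball p0 r. *)
Definition half_strainer_map (k : nat) (delta : R) x p0 (r : R)
    (f : X -> 'rV[R]_k) : Prop :=
  exists B (p : 'I_k -> X),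
    [/\ tiny_ball B, B x, extended_strainer B delta x p0 p,
        r = mdist p0 x &
        {in metric_cball p0 r, forall y, f y = \row_i mdist (p i) y}].

End metric.

(* Main.v *)
Require Import Defs.
From HB Require Import structures.
From mathcomp Require Import all_boot all_order all_algebra.
From mathcomp Require Import all_classical all_reals all_analysis.
From mathcomp Require Import ring lra.
Import Order.TTheory GRing.Theory Num.Theory.
Import numFieldNormedType.Exports.
Local Open Scope classical_set_scope.
Local Open Scope ring_scope.
Set Implicit Arguments.
Unset Strict Implicit.
Unset Printing Implicit Defensive.

(** Write d_i for the distance to p_i, f = (d_1, ..., d_k) and d_0 for the
    distance to the base point.  The neighborhood is
      V = { y : |xy| < r, |f(y) - f(x)| < eps, d_0(y) <= d_0(x) },
    with eps a small multiple of r, and everything is deduced from two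
    continuous maps.
    The first, [contraction], contracts V to x.  The second, [transport], sends
    (y, b) in V * f(V) to a point of V in the fiber of b, and sends (y, f(y))
    to y.  Such a map lifts every homotopy H that starts at f o h, by
    G(z, t) = transport (h(z), H(z, t)); and it turns the contraction of V into
    a contraction of each fiber.

    Both maps first push y towards x along the shortest path [x, y], and then
    repair the value of f by a map [correct] that moves a point z to a point
    with prescribed f = b, over a distance at most a constant times |f(z) - b|
    and without increasing d_0.

    The repair is a Newton iteration.  The angle conditions say that moving
    towards p_i or towards its opposite strainer changes d_i at a speed close
    to 1, and changes d_0 and the d_j with j < i at a speed close to 0.
    Nothing is known about the effect on the d_j with j > i, but since the
    system is nearly triangular, adjusting d_1, ..., d_k in this order
    multiplies the error by a small factor.  An initial move towards p_0 makes
    up for the small increase of d_0 during the iteration.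

    Pushing towards x must not cost more in the repair than it gains in
    distance to x, so f has to be almost affine on [x, y].  This is
    [uniform_slope]: the difference quotients of the convex function d_i along
    a shortest path issuing from x decrease to a limit at x, they are
    equicontinuous in the path because of the Busemann inequality, hence
    converge uniformly on the compact sphere of directions; and geodesic
    completeness extends [x, y] beyond y, so that the slope of d_i at y is
    bounded by a difference quotient further out. *)

(** * Shortest paths in balls of nonpositive curvature *)

Section segments.
Variables (R : realType) (X : metricType R).
Implicit Types (p q x y z : X) (B Y : set X) (g h : R -> X) (s t : R).

(** Shortest paths are parametrized proportionally to arc length on [0, 1],
    which is the form in which the Busemann inequality is linear. *)
Definition segment y z g : Prop :=
  [/\ g 0 = y, g 1 = z &
    forall s t, 0 <= s <= 1 -> 0 <= t <= 1 ->
      mdist (g s) (g t) = `|s - t| * mdist y z].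

(** The consequences of the BNPC property of the tenfold closed ball that are
    used inside a tiny ball.  Here [segment] refers to all shortest paths of
    the ambient space, so that the regions are convex in the strong sense. *)
Record busemann_region B : Prop := BusemannRegion {
  region_geodesic : forall y z, B y -> B z -> exists g, segment y z g;
  region_convex : forall y z g t, B y -> B z -> segment y z g ->
    0 <= t <= 1 -> B (g t);
  region_busemann : forall y z y' z' g h t,
    B y -> B z -> B y' -> B z' -> segment y z g -> segment y' z' h ->
    0 <= t <= 1 ->
    mdist (g t) (h t) <= (1 - t) * mdist y y' + t * mdist z z' }.

Lemma segment_const y : segment y y (fun=> y).
Proof. by split => // s t _ _; rewrite !mdistxx mulr0. Qed.

Lemma segment_constant_speed Y y z g : segment y z g ->
  (forall t, 0 <= t <= 1 -> Y (g t)) -> constant_speed_shortest_path Y g.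
Proof.
move=> [g0 g1 gE] gY; split; last by move=> t; rewrite in_itv/=; exact: gY.
have [yz|yz] := eqVneq (mdist y z) 0.
  exists 0, 0, (fun=> y); split => //.
    move=> s t; rewrite !in_itv/= => s0 t0; rewrite mdistxx.
    by rewrite (_ : s - t = 0) ?normr0//; lra.
  move=> t; rewrite in_itv/= => t01; rewrite -g0; apply: mdist_positivity.
  by rewrite gE ?yz ?mulr0// lexx ler01.
have L0 : 0 < mdist y z by rewrite lt_neqAle eq_sym yz mdist_ge0.
exists 0, (mdist y z), (fun s => g (s / mdist y z)); split => //.
- exact: ltW.
- move=> s t; rewrite !in_itv/= => /andP[s0 s1] /andP[t0 t1].
  rewrite gE; last 2 first.
  + by rewrite ler_pdivrMr// mul1r ?s1 ?t1 divr_ge0// ltW.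
  + by rewrite ler_pdivrMr// mul1r ?s1 ?t1 divr_ge0// ltW.
  rewrite -mulrBl normrM (gtr0_norm (x := _^-1)) ?invr_gt0//.
  by rewrite -mulrA mulVf ?mulr1.
- by move=> t _; rewrite add0r subr0 mulfK.
Qed.

Lemma bnpc_busemann Y y z y' z' g h t : bnpc Y ->
  segment y z g -> segment y' z' h ->
  (forall s, 0 <= s <= 1 -> Y (g s)) -> (forall s, 0 <= s <= 1 -> Y (h s)) ->
  0 <= t <= 1 ->
  mdist (g t) (h t) <= (1 - t) * mdist y y' + t * mdist z z'.
Proof.
move=> [_ _ cvx] sg sh gY hY t01.
have /(_ (Itv01 (proj1 (andP t01)) (proj2 (andP t01))) 1 0) :=
  cvx _ _ (segment_constant_speed sg gY) (segment_constant_speed sh hY).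
rewrite !inE/= !in_itv/= !lexx !ler01/= => /(_ isT isT).
move=> H.
have {H} : mdist (g (t * 1 + (1 - t) * 0)) (h (t * 1 + (1 - t) * 0)) <=
    t * mdist (g 1) (h 1) + (1 - t) * mdist (g 0) (h 0) := H.
rewrite mulr0 addr0 mulr1.
by case: sg => -> -> _; case: sh => -> -> _; rewrite addrC.
Qed.

(** A shortest path between two points of the ball of radius r stays at
    distance less than 3r from the center, hence inside the BNPC ball; applying
    the Busemann inequality to it and the constant path at the center shows
    that it does not leave the ball of radius r. *)
Lemma tiny_ball_region B : tiny_ball B -> busemann_region B.
Proof.
move=> [c [r [r0 -> _ bK]]].
have BE y : ball c r y = (mdist c y < r) :> Prop by rewrite ballEmdist.
have inK y z g t : ball c r y -> ball c r z -> segment y z g ->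
    0 <= t <= 1 -> metric_cball c (10 * r) (g t).
  rewrite !BE /metric_cball/= => yB zB [g0 g1 gE] t01.
  have h1 := metric_triangle c y (g t).
  have h2 := metric_triangle y c z.
  have : mdist y (g t) <= mdist y z.
    rewrite -{1}g0 gE ?lexx ?ler01// sub0r normrN ger0_norm; last by lra.
    by rewrite ler_piMl ?mdist_ge0//; lra.
  by rewrite (metric_sym y c) in h2; lra.
split.
- move=> y z; rewrite !BE => yB zB.
  have [_ /(_ y z) geoK _] := bK.
  have [||g [gs g0 g1] gK] := geoK; rewrite /metric_cball/=; [lra..|].
  exists (fun t => g (t * mdist y z)); split; rewrite ?mul0r ?mul1r//.
  have L0 := mdist_ge0 y z.
  move=> s t /andP[s0 s1] /andP[t0 t1]; rewrite gs.
  + by rewrite -mulrBl normrM (ger0_norm (mdist_ge0 _ _)).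
  + by rewrite in_itv/= mulr_ge0//= ler_piMl.
  + by rewrite in_itv/= mulr_ge0//= ler_piMl.
- move=> y z g t yB zB sg t01.
  have := @bnpc_busemann _ _ _ _ _ _ _ t bK (segment_const c) sg.
  have cB : ball c r c by rewrite BE mdistxx.
  move=> /(_ (fun s => inK _ _ _ s cB cB (segment_const c))).
  move=> /(_ (fun s => inK _ _ _ s yB zB sg) t01).
  rewrite !BE in yB zB * => /le_lt_trans; apply.
  have [t0|t0] := eqVneq t 0; first by rewrite t0; lra.
  have : 0 < t by rewrite lt_neqAle eq_sym t0; case/andP: t01.
  by nra.
- move=> y z y' z' g h t yB zB yB' zB' sg sh t01.
  by apply: (bnpc_busemann bK sg sh _ _ t01) => s;
    [exact: (inK y z)|exact: (inK y' z')].
Qed.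

Lemma segment_sub y z g s t : segment y z g -> 0 <= s -> s <= t -> t <= 1 ->
  segment (g s) (g t) (fun u => g (s + u * (t - s))).
Proof.
move=> [_ _ gE] s0 st t1; split; rewrite ?mul0r ?mul1r ?addr0 ?subrKC//.
have inI u : 0 <= u <= 1 -> 0 <= s + u * (t - s) <= 1.
  move=> /andP[u0 u1].
  have h1 : 0 <= u * (t - s) by rewrite mulr_ge0// subr_ge0.
  have h2 : 0 <= (1 - u) * (t - s) by rewrite mulr_ge0// subr_ge0.
  by apply/andP; split; lra.
move=> u v /[dup] /inI ? ? /[dup] /inI ? ?.
have s01 : 0 <= s <= 1 by lra.
have t01 : 0 <= t <= 1 by lra.
rewrite !gE// (_ : _ - _ = (u - v) * (t - s)); last by ring.
by rewrite normrM (distrC s t) mulrA.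
Qed.

Lemma segment_dist y z g t : segment y z g -> 0 <= t <= 1 ->
  mdist y (g t) = t * mdist y z /\ mdist (g t) z = (1 - t) * mdist y z.
Proof.
move=> [g0 g1 gE] t01.
rewrite -{1}g0 -{2}g1 !gE ?lexx ?ler01// sub0r normrN distrC.
by rewrite !ger0_norm//; lra.
Qed.

Definition geo y z : R -> X := xget (fun=> y) [set g | segment y z g].

Section region.
Variables (B : set X) (HB : busemann_region B).

Lemma geoP y z : B y -> B z -> segment y z (geo y z).
Proof.
move=> By Bz; have [g gP] := region_geodesic HB By Bz.
exact: (xgetPex (fun=> y) (ex_intro _ g gP)).
Qed.

Lemma geo_in y z t : B y -> B z -> 0 <= t <= 1 -> B (geo y z t).
Proof. by move=> By Bz; apply: (region_convex HB By Bz); exact: geoP. Qed.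

Lemma geo0 y z : B y -> B z -> geo y z 0 = y.
Proof. by move=> By Bz; case: (geoP By Bz). Qed.

Lemma geo1 y z : B y -> B z -> geo y z 1 = z.
Proof. by move=> By Bz; case: (geoP By Bz). Qed.

Lemma segment_uniq y z g t : B y -> B z -> segment y z g -> 0 <= t <= 1 ->
  g t = geo y z t.
Proof.
move=> By Bz sg t01; apply: mdist_positivity; apply/eqP.
rewrite eq_le mdist_ge0 andbT.
have := region_busemann HB By Bz By Bz sg (geoP By Bz) t01.
by rewrite !mdistxx !mulr0 addr0.
Qed.

Lemma mdist_geoE y z s t : B y -> B z -> 0 <= s <= 1 -> 0 <= t <= 1 ->
  mdist (geo y z s) (geo y z t) = `|s - t| * mdist y z.
Proof. by move=> By Bz s01 t01; case: (geoP By Bz) => _ _; exact. Qed.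

Lemma mdist_geo y z t : B y -> B z -> 0 <= t <= 1 ->
  mdist y (geo y z t) = t * mdist y z /\
  mdist (geo y z t) z = (1 - t) * mdist y z.
Proof. by move=> By Bz; apply: segment_dist; exact: geoP. Qed.

Lemma geo_busemann y z y' z' t : B y -> B z -> B y' -> B z' -> 0 <= t <= 1 ->
  mdist (geo y z t) (geo y' z' t) <= (1 - t) * mdist y y' + t * mdist z z'.
Proof.
by move=> *; apply: (region_busemann HB) => //; exact: geoP.
Qed.

Lemma segment_convex p y z g t : B p -> B y -> B z -> segment y z g ->
  0 <= t <= 1 -> mdist p (g t) <= (1 - t) * mdist p y + t * mdist p z.
Proof.
move=> Bp By Bz sg t01.
exact: (region_busemann HB Bp Bp By Bz (segment_const p) sg).
Qed.

Lemma geo_convex3 p y z a m b : B p -> B y -> B z ->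
  0 <= a -> a <= m -> m <= b -> b <= 1 ->
  (b - a) * mdist p (geo y z m) <=
    (b - m) * mdist p (geo y z a) + (m - a) * mdist p (geo y z b).
Proof.
move=> Bp By Bz a0 am mb b1.
have [ab|ab] := eqVneq a b.
  have -> : m = a by lra.
  by rewrite -ab; lra.
have ba0 : 0 < b - a by rewrite subr_gt0 lt_neqAle ab; lra.
have sg := segment_sub (geoP By Bz) a0 (le_trans am mb) b1.
have t01 : 0 <= (m - a) / (b - a) <= 1.
  by apply/andP; split; [rewrite divr_ge0; lra|rewrite ler_pdivrMr//; lra].
have := segment_convex Bp _ _ sg t01.
rewrite divfK ?gt_eqF// subrKC => /(_ _ _)/(ler_wpM2l (ltW ba0)) h.
apply: (le_trans (h _ _)); [apply: geo_in => //; lra..|].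
by rewrite le_eqVlt; apply/orP; left; apply/eqP; field; rewrite gt_eqF.
Qed.

Lemma geo_sub y z s t u : B y -> B z -> 0 <= s -> s <= t -> t <= 1 ->
  0 <= u <= 1 -> geo (geo y z s) (geo y z t) u = geo y z (s + u * (t - s)).
Proof.
move=> By Bz s0 st t1 u01.
have sg := segment_sub (geoP By Bz) s0 st t1.
rewrite -(segment_uniq _ _ sg)//; apply: geo_in => //; lra.
Qed.

End region.
End segments.

(** * Distances and limits *)

Section distance.
Variables (R : realType) (X : metricType R).
Implicit Types (p q x y z : X) (s t : R).

Lemma mdist_lip p y z : `|mdist p y - mdist p z| <= mdist y z.
Proof.
have h1 := metric_triangle p y z; have h2 := metric_triangle p z y.
by rewrite (metric_sym z y) in h2; rewrite ler_norml; lra.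
Qed.

Lemma cvg_metricP (T : Type) (F : set_system T) {FF : Filter F} (z_ : T -> X) z :
  z_ @ F --> z <-> mdist z (z_ t) @[t --> F] --> 0.
Proof.
split.
  move=> /metricType_numDomainType.cvgrPdist_lt zz; apply/cvgrPdist_lt => e e0.
  apply: filterS (zz e e0) => t; rewrite sub0r normrN.
  by rewrite ger0_norm// mdist_ge0.
move=> /cvgrPdist_lt zz; apply/metricType_numDomainType.cvgrPdist_lt => e e0.
apply: filterS (zz e e0) => t; rewrite sub0r normrN.
by rewrite ger0_norm// mdist_ge0.
Qed.

Lemma cvg_mdist (T : Type) (F : set_system T) (z_ w_ : T -> X) z w :
  Filter F -> z_ @ F --> z -> w_ @ F --> w ->
  mdist (z_ t) (w_ t) @[t --> F] --> mdist z w.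
Proof.
move=> FF /cvg_metricP zz /cvg_metricP ww; apply/cvgrPdist_le => e e0.
have e2 : 0 < e / 2 by lra.
move/cvgrPdist_le: zz => /(_ _ e2) zz; move/cvgrPdist_le: ww => /(_ _ e2) ww.
apply: filterS2 zz ww => t; rewrite !sub0r !normrN !(ger0_norm (mdist_ge0 _ _)).
move=> h1 h2.
have := mdist_lip z w (w_ t); have := mdist_lip (w_ t) z (z_ t).
rewrite (metric_sym (w_ t) z) (metric_sym (w_ t) (z_ t)) !ler_norml.
by lra.
Qed.

Lemma mdist_continuous x : continuous (mdist x : X -> R).
Proof. by move=> y; apply: cvg_mdist => //; exact: cvg_cst. Qed.

Lemma closed_cball x (r : R) : closed (metric_cball x r).
Proof.
rewrite (_ : metric_cball x r = mdist x @^-1` [set s : R | s <= r])//.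
by apply: preimage_closed; [move=> y _; exact: mdist_continuous|exact: closed_le].
Qed.

Lemma closed_sphere x (r : R) : closed (metric_sphere x r).
Proof.
rewrite (_ : metric_sphere x r = mdist x @^-1` [set r])//.
by apply: preimage_closed; [move=> y _; exact: mdist_continuous|exact: closed_eq].
Qed.

End distance.

(** * Angles as slopes of distance functions *)

Section angles.
Variables (R : realType).

Lemma cvg_acos (T : Type) (F : set_system T) (c : T -> R) (l : R) :
  Filter F -> c @ F --> l -> -1 <= l <= 1 ->
  (\forall t \near F, -1 <= c t <= 1) -> acos (c t) @[t --> F] --> acos l.
Proof.
move=> FF cl l1 c1.
have pi0 : (0 : R) <= pi by exact: pi_ge0.
have coscont : {within `[0, pi], continuous (@cos R)}.
  by apply: continuous_subspaceT; exact: continuous_cos.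
have := segment_can_ge_continuous pi0 coscont (@cosK R).
rewrite cospi cos0 => /subspace_continuousP /(_ l).
rewrite /= in_itv/= => /(_ l1) acosl.
move=> A nA.
have {}nA : nbhs l [set x | `[-1, 1]%classic x -> A (acos x)] := acosl A nA.
have := cl _ nA; rewrite /nbhs/= => h; apply: filterS2 h c1 => t h ct.
by apply: h; rewrite /= in_itv.
Qed.

Variable X : metricType R.
Implicit Types (p q x y z : X) (B Y : set X) (g h : R -> X) (s t : R).
Variables (B : set X) (HB : busemann_region B).

(** The first variation formula: minus the cosine of the angle is the right
    derivative at y of the distance to p along the shortest path from y to q.
    Convexity gives the global lower bound, and monotonicity of the difference
    quotients the upper bound near y. *)
Lemma angle_slope p q y : B p -> B q -> B y -> y <> p -> y <> q ->
  let D := - cos (angle p y q) in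
  0 <= angle p y q <= pi /\
  (forall t, 0 <= t <= 1 ->
     mdist p y + D * (t * mdist y q) <= mdist p (geo y q t)) /\
  (forall e, 0 < e -> exists2 t0, 0 < t0 <= 1 &
     forall t, 0 <= t <= t0 ->
     mdist p (geo y q t) <= mdist p y + (D + e) * (t * mdist y q)).
Proof.
move=> Bp Bq By yp yq.
set L := mdist y q; set a := mdist p y.
have L0 : 0 < L by rewrite mdist_gt0; apply/eqP.
have a0 : 0 < a by rewrite mdist_gt0 eq_sym; apply/eqP.
pose phi t := mdist p (geo y q t).
pose psi t := (phi t - a) / (t * L).
pose S := [set psi t | t in [set t | 0 < t <= 1]].
have phitri t : 0 <= t <= 1 -> a - t * L <= phi t <= a + t * L.
  move=> t01; have [dt _] := mdist_geo HB By Bq t01.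
  have h1 := metric_triangle p y (geo y q t).
  have h2 := metric_triangle p (geo y q t) y.
  rewrite (metric_sym (geo y q t)) dt in h2; rewrite dt in h1.
  by apply/andP; split; rewrite /phi /a /L; lra.
have tL t : 0 < t -> 0 < t * L by move=> t0; rewrite mulr_gt0.
have psib t : 0 < t <= 1 -> -1 <= psi t <= 1.
  move=> /andP[t0 t1]; have /phitri h : 0 <= t <= 1 by lra.
  by rewrite /psi ler_pdivlMr ?tL// ler_pdivrMr ?tL//; lra.
have S0 : S !=set0 by exists (psi 1), 1 => //=; lra.
have Slb : lbound S (-1) by move=> _ [t /psib + <-]; lra.
have Sinf : has_inf S by split => //; exists (-1).
have psimono s t : 0 < s -> s <= t -> t <= 1 -> psi s <= psi t.
  move=> s0 st t1; rewrite /psi ler_pdivrMr ?tL// mulrAC.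
  rewrite ler_pdivlMr ?tL//; last by lra.
  have := geo_convex3 HB Bp By Bq (lexx 0) (ltW s0) st t1.
  rewrite (geo0 HB By Bq) -/(phi t) -/(phi s) -/a !subr0 => h.
  suff : t * (phi s - a) * L <= (phi t - a) * s * L by lra.
  by apply: ler_wpM2r; lra.
pose D := inf S.
have Dle t : 0 < t <= 1 -> D <= psi t.
  by move=> t01; apply: ge_inf; [exists (-1)|exists t].
have Dap e : 0 < e -> exists2 t0, 0 < t0 <= 1 &
    forall t, 0 < t <= t0 -> psi t < D + e.
  move=> e0; have [_ [t0 t01 <-] h] := inf_adherent e0 Sinf.
  exists t0 => // t tt0; apply: le_lt_trans h.
  by case/andP: t01 => *; apply: psimono; lra.
have D1 : -1 <= D <= 1.
  apply/andP; split; first exact: lb_le_inf.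
  have h1 : 0 < (1 : R) <= 1 by rewrite ltr01 lexx.
  by have := Dle _ h1; have := psib _ h1; lra.
(* The law of cosines writes the cosine of the comparison angle as
   - psi (1 + t psi / (2a)) + t / (2a), where psi is the difference quotient at
   time t, and psi tends to its infimum D. *)
have DE : cos (angle p y q) = - D /\ 0 <= angle p y q <= pi.
  suff -> : angle p y q = acos (- D).
    by have [] := @acos_def R (- D); [lra|].
  rewrite /angle; set g := some_shortest_path y q.
  have sg : shortest_path_from_to y q g.
    apply: (@xgetPex _ (fun=> y) [set g | shortest_path_from_to y q g]).
    have [g0 g1 gE] := geoP HB By Bq.
    exists (fun s => geo y q (s / L)); split => /=.
    - move=> s t; rewrite !in_itv/= => /andP[s0 sL] /andP[t0 t1].
      rewrite gE; last 2 first.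
      + by rewrite ler_pdivrMr// mul1r ?sL divr_ge0// ltW.
      + by rewrite ler_pdivrMr// mul1r ?t1 divr_ge0// ltW.
      rewrite -mulrBl normrM (gtr0_norm (x := _^-1)) ?invr_gt0//.
      by rewrite -mulrA mulVf ?mulr1// gt_eqF.
    - by rewrite mul0r.
    - by rewrite divff// gt_eqF.
  case: sg => sg g0 g1.
  have gE t : 0 <= t <= L -> g t = geo y q (t / L).
    move=> tL'; rewrite -(@segment_uniq _ _ _ HB _ _ (fun u => g (u * L)));
      rewrite ?divfK ?gt_eqF//.
      split; rewrite ?mul0r ?mul1r// => u v u01 v01.
      have uL w : 0 <= w <= 1 -> w * L \in `[0, mdist y q].
        move=> /andP[w0 w1].
        by rewrite in_itv/= mulr_ge0 ?(ltW L0)// ler_piMl// ltW.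
      by rewrite sg ?uL// -mulrBl normrM (gtr0_norm L0).
    by rewrite ler_pdivrMr// mul1r divr_ge0 ?(ltW L0)//; lra.
  apply/cvg_lim => //.
  have nearL : \forall t \near (0:R)^'+, 0 < t <= L.
    near=> t; apply/andP; split; first by near: t; exact: nbhs_right_gt.
    by near: t; exact: nbhs_right_le.
  have psicvg : psi (t / L) @[t --> 0^'+] --> D.
    apply/cvgrPdist_le => e e0; have [t0 /andP[t00 t01] h] := Dap e e0.
    near=> t.
    have tp : 0 < t by near: t; exact: nbhs_right_gt.
    have tle : t <= t0 * L by near: t; apply: nbhs_right_le; rewrite mulr_gt0.
    have hL : 0 < t / L <= t0 by rewrite divr_gt0//= ler_pdivrMr.
    have := h _ hL; have := Dle (t / L).
    move=> /(_ ltac:(lra)) h1 h2.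
    by rewrite distrC ger0_norm; lra.
  apply: (@cvg_acos R (0 : R)^'+ (fun t => (mdist p y ^+ 2 + mdist y (g t) ^+ 2 -
    mdist p (g t) ^+ 2) / (2 * mdist p y * mdist y (g t)))); [|lra|].
  - apply: (@cvg_trans _ ((- psi (t / L) * (1 + t * psi (t / L) / (2 * a)) +
        t / (2 * a)) @[t --> 0^'+])).
      apply: near_eq_cvg; near=> t.
      have /andP[t0 tl] : 0 < t <= L by near: t.
      have tL01 : 0 <= t / L <= 1.
        by rewrite ler_pdivrMr// mul1r ?tl divr_ge0// ltW.
      have [dt _] := mdist_geo HB By Bq tL01.
      rewrite gE ?(ltW t0)// dt -/L divfK ?gt_eqF// -/(phi _) /psi -/a.
      rewrite divfK ?gt_eqF//.
      by field; rewrite !gt_eqF.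
    have tc : (t:R) @[t --> (0:R)^'+] --> (0:R) by apply: cvg_at_right_filter.
    rewrite (_ : - D = - D * (1 + 0 * D / (2 * a)) + 0 / (2 * a)); last first.
      by rewrite !mul0r !addr0 mulr1.
    apply: cvgD; last by apply: cvgM => //; exact: cvg_cst.
    apply: cvgM; first exact: cvgN.
    apply: cvgD; first exact: cvg_cst.
    apply: cvgM; last exact: cvg_cst.
    exact: cvgM.
  - near=> t.
    have /andP[t0 tl] : 0 < t <= L by near: t.
    have tL01 : 0 <= t / L <= 1.
        by rewrite ler_pdivrMr// mul1r ?tl divr_ge0// ltW.
    have [dt _] := mdist_geo HB By Bq tL01.
    rewrite gE ?(ltW t0)// dt -/L divfK ?gt_eqF// -/(phi _) -/a.
    have := phitri _ tL01; rewrite divfK ?gt_eqF// => /andP[p1 p2].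
    have p0 : 0 <= phi (t / L) by exact: mdist_ge0.
    have ta : 0 < 2 * a * t by rewrite mulr_gt0// mulr_gt0.
    have ta' : t <= a \/ a <= t by case/orP: (le_total t a); [left|right].
    have p3 : t - a <= phi (t / L).
      have := metric_triangle y p (geo y q (t / L)).
      by rewrite dt -/L divfK ?gt_eqF// (metric_sym y p) -/a -/(phi _); lra.
    rewrite ler_pdivlMr// ler_pdivrMr//.
    by apply/andP; split; nra.
case: DE => DE a01; rewrite /= DE opprK; split => //; split.
- move=> t /andP[t0 t1]; have [->|tn0] := eqVneq t 0.
    by rewrite (geo0 HB By Bq) mul0r mulr0 addr0.
  have tp : 0 < t <= 1 by rewrite lt_neqAle eq_sym tn0 t0.
  have := Dle _ tp; rewrite /psi ler_pdivlMr; last by apply: tL; lra.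
  by rewrite -/(phi t); lra.
- move=> e e0; have [t0 t01 h] := Dap e e0; exists t0 => // t /andP[tp0 tt0].
  have [->|tn0] := eqVneq t 0.
    by rewrite (geo0 HB By Bq) mul0r mulr0 addr0.
  have tp : 0 < t <= t0 by rewrite lt_neqAle eq_sym tn0 tp0.
  have := h _ tp; rewrite /psi ltr_pdivrMr; last by apply: tL; lra.
  by rewrite -/(phi t); lra.
Unshelve. all: by end_near. Qed.

End angles.
Section toward.
Variables (R : realType) (X : metricType R).
Implicit Types (p q x y z : X) (s t : R).
Variables (B : set X) (HB : busemann_region B).

Definition clamp s : R := Num.max 0 (Num.min 1 s).

Lemma clamp01 s : 0 <= clamp s <= 1.
Proof.
by rewrite /clamp le_max lexx/= ge_max ler01/= ge_min lexx.
Qed.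

Lemma clamp_id s : 0 <= s <= 1 -> clamp s = s.
Proof.
by move=> /andP[s0 s1]; rewrite /clamp min_r// max_r.
Qed.

Lemma clamp_lip s t : `|clamp s - clamp t| <= `|s - t|.
Proof.
rewrite /clamp; have := ler_norm (s - t); have := ler_norm (t - s).
rewrite (distrC t s) ler_norml => h1 h2.
case: (leP 1 s) => s1; case: (leP 1 t) => t1;
  rewrite ?(max_r ler01) /Num.max; repeat case: ifP => ?; lra.
Qed.

(** The point at distance s from z on the way to q.  The clamping makes z a
    fixed point for s <= 0, so that moves in two opposite directions can be
    composed without distinguishing cases, see [shift]. *)
Definition toward q z s : X := geo z q (clamp (s / mdist z q)).

Lemma toward_in q z s : B q -> B z -> B (toward q z s).
Proof. by move=> Bq Bz; apply: (geo_in HB) => //; exact: clamp01. Qed.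

Lemma toward_le0 q z s : B q -> B z -> s <= 0 -> toward q z s = z.
Proof.
move=> Bq Bz s0; rewrite /toward /clamp max_l ?(geo0 HB)//.
rewrite ge_min; apply/orP; right.
by rewrite mulr_le0_ge0// invr_ge0 mdist_ge0.
Qed.

Lemma mdist_toward q z s : B q -> B z -> 0 <= s ->
  mdist z (toward q z s) <= s.
Proof.
move=> Bq Bz s0; have [-> _] := mdist_geo HB Bz Bq (clamp01 (s / mdist z q)).
have [L0|L0] := eqVneq (mdist z q) 0; first by rewrite L0 mulr0.
have L1 : 0 < mdist z q by rewrite lt_neqAle eq_sym L0 mdist_ge0.
rewrite -ler_pdivlMr// /clamp ge_max divr_ge0//= ?mdist_ge0//.
by rewrite ge_min lexx orbT.
Qed.

Lemma cvg_geo (T : Type) (F : set_system T) (y_ z_ : T -> X) (l_ : T -> R)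
    y z (l : R) : Filter F -> open B -> B y -> B z ->
  y_ @ F --> y -> z_ @ F --> z -> l_ @ F --> l ->
  geo (y_ t) (z_ t) (clamp (l_ t)) @[t --> F] --> geo y z (clamp l).
Proof.
move=> FF oB By Bz yy zz ll.
have yB : \forall t \near F, B (y_ t) by apply: yy; exact: open_nbhs_nbhs.
have zB : \forall t \near F, B (z_ t) by apply: zz; exact: open_nbhs_nbhs.
have ll0 : `|l - l_ t| @[t --> F] --> (0 : R).
  rewrite -(normr0 R) -(subrr l).
  by apply: cvg_norm; apply: cvgB => //; exact: cvg_cst.
apply/cvg_metricP.
have bound : `|l - l_ t| * mdist y z + (mdist y (y_ t) + mdist z (z_ t))
    @[t --> F] --> 0 * mdist y z + (0 + 0).
  apply: cvgD; first by apply: cvgM => //; exact: cvg_cst.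
  by apply: cvgD; exact/cvg_metricP.
rewrite mul0r !addr0 in bound.
apply: squeeze_cvgr bound; last exact: cvg_cst.
apply: filterS2 yB zB => t Byt Bzt; rewrite mdist_ge0/=.
apply: le_trans (metric_triangle _ (geo y z (clamp (l_ t))) _) _; apply: lerD.
  by rewrite (mdist_geoE HB By Bz) ?clamp01// ler_wpM2r ?mdist_ge0 ?clamp_lip.
apply: le_trans (geo_busemann HB By Bz Byt Bzt (clamp01 (l_ t))) _.
have /andP[c0 c1] := clamp01 (l_ t).
by apply: lerD; rewrite ler_piMl ?mdist_ge0//; lra.
Qed.

Lemma cvg_toward (T : Type) (F : set_system T) (z_ : T -> X) (s_ : T -> R)
    q z s : Filter F -> open B -> B q -> B z -> z <> q ->
  z_ @ F --> z -> s_ @ F --> s ->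
  toward q (z_ t) (s_ t) @[t --> F] --> toward q z s.
Proof.
move=> FF oB Bq Bz zq zz ss; apply: cvg_geo => //; first exact: cvg_cst.
have L0 : mdist z q != 0 by rewrite gt_eqF// mdist_gt0; apply/eqP.
apply: cvgM => //; apply: cvgV => //.
by apply: cvg_mdist => //; exact: cvg_cst.
Qed.

Lemma toward_self p z s : B p -> B z -> 0 <= s -> s <= mdist z p ->
  mdist p (toward p z s) = mdist p z - s.
Proof.
move=> Bp Bz s0 sp.
have [L0|L0] := eqVneq (mdist z p) 0.
  have -> : s = 0 by lra.
  by rewrite toward_le0// subr0.
have L1 : 0 < mdist z p by rewrite lt_neqAle eq_sym L0 mdist_ge0.
have l01 : 0 <= s / mdist z p <= 1.
  by rewrite ler_pdivrMr// mul1r sp divr_ge0// ltW.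
rewrite /toward clamp_id// metric_sym (mdist_geo HB Bz Bp l01).2 (metric_sym p z).
by field.
Qed.

Lemma toward_slope_ge p q z s : B p -> B q -> B z -> z <> p -> z <> q ->
  0 <= s -> s <= mdist z q ->
  mdist p z - cos (angle p z q) * s <= mdist p (toward q z s).
Proof.
move=> Bp Bq Bz zp zq s0 sq.
have L1 : 0 < mdist z q by rewrite mdist_gt0; apply/eqP.
have l01 : 0 <= s / mdist z q <= 1.
  by rewrite ler_pdivrMr// mul1r sq divr_ge0// ltW.
have [_ [/(_ _ l01) + _]] := angle_slope HB Bp Bq Bz zp zq.
by rewrite divfK ?gt_eqF// mulNr /toward clamp_id.
Qed.

(** By convexity the mean slope on a path is at most the right derivative at
    its end point, so here the angle is measured at the end point; it is there
    that the angle condition of a strainer bounds the slope from above. *)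
Lemma toward_slope_le p q z s : B p -> B q -> B z -> z <> q ->
  0 <= s -> s < mdist z q -> toward q z s <> p ->
  mdist p (toward q z s) <= mdist p z - cos (angle p (toward q z s) q) * s.
Proof.
move=> Bp Bq Bz zq s0 sq.
have L1 : 0 < mdist z q by rewrite mdist_gt0; apply/eqP.
set t := s / mdist z q.
have t01 : 0 <= t <= 1 by rewrite /t ler_pdivrMr// mul1r (ltW sq) divr_ge0// ltW.
have t1 : t < 1 by rewrite /t ltr_pdivrMr// mul1r.
have sE : s = t * mdist z q by rewrite /t divfK// gt_eqF.
rewrite /toward -/t clamp_id// => y'p.
have By' := geo_in HB Bz Bq t01.
have dy' := (mdist_geo HB Bz Bq t01).2.
have y'q : geo z q t <> q.
  by apply/eqP; rewrite -mdist_gt0 dy' mulr_gt0//; lra.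
have [_ [_]] := angle_slope HB Bp Bq By' y'p y'q.
set D := - cos _ => hD; rewrite -mulNr -/D.
apply/ler_addgt0Pr => e e0.
have eL : 0 < e / mdist z q by rewrite divr_gt0.
have [u /andP[u0 u1] /(_ u)] := hD _ eL.
rewrite lexx (ltW u0) => /(_ isT).
rewrite {1}(_ : geo (geo z q t) q u = geo z q (t + u * (1 - t))); last first.
  by rewrite -(geo_sub HB Bz Bq)//; [rewrite (geo1 HB Bz Bq)|lra..].
rewrite dy' => h.
have := geo_convex3 HB Bp Bz Bq (lexx 0) (_ : 0 <= t)
  (_ : t <= t + u * (1 - t)) (_ : t + u * (1 - t) <= 1).
have u't : 0 < u * (1 - t) by rewrite mulr_gt0//; lra.
have u'1 : t + u * (1 - t) <= 1 by nra.
move=> /(_ ltac:(lra) ltac:(lra) ltac:(lra)).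
rewrite (geo0 HB Bz Bq) !subr0 => h2.
have h3 : t * mdist p (geo z q (t + u * (1 - t))) <=
   t * (mdist p (geo z q t) + (D + e / mdist z q) * (u * ((1 - t) * mdist z q))).
  by apply: ler_wpM2l => //; lra.
have h4 : u * (1 - t) * (mdist p (geo z q t)) <=
    u * (1 - t) * (mdist p z + D * s + e).
  have -> : e = e / mdist z q * mdist z q by rewrite divfK// gt_eqF.
  rewrite sE; set w := e / mdist z q in h3 eL *.
  have ht : 0 <= 1 - t by lra.
  have := mulr_ge0 (mulr_ge0 (mulr_ge0 (ltW u't) ht) (ltW eL)) (ltW L1).
  by rewrite -/w; lra.
by rewrite ler_pM2l in h4.
Qed.

End toward.

(** * Slopes near a strained point *)

Section strainers.
Variables (R : realType).

Lemma small_angle (e : R) : 0 < e -> exists2 d : R, 0 < d &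
  forall a : R, `|a| < d -> 1 - e <= cos a /\ `|sin a| <= e.
Proof.
move=> e0.
have cc : cos (x : R) @[x --> (0 : R)] --> (1 : R).
  by rewrite -cos0; exact: continuous_cos.
have cs : sin (x : R) @[x --> (0 : R)] --> (0 : R).
  by rewrite -{2}sin0; exact: continuous_sin.
move/cvgrPdist_le: cc => /(_ _ e0) cc; move/cvgrPdist_le: cs => /(_ _ e0) cs.
have /nbhs_ballP[d /= d0 h] :
    nbhs (0 : R) [set a | 1 - e <= cos a /\ `|sin a| <= e].
  apply: filterS2 cc cs => a /=; rewrite sub0r normrN => h1 h2; split => //.
  by move: h1; rewrite ler_norml; lra.
exists d => // a ad; apply: (h a).
by rewrite -ball_normE /= sub0r normrN.
Qed.

Variable X : metricType R.
Implicit Types (p q x y z : X) (s t : R).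
Variables (B : set X) (delta : R) (x : X).

Lemma strainer_opposite k (p pbar : 'I_k -> X) i :
  strainer_with B delta x p pbar -> opposite_strainer B delta (p i) (pbar i) x.
Proof.
elim: k p pbar i => [|k IH] p pbar i /=; first by case: i.
move=> [st op _]; have [ik|ik] := eqVneq i ord_max; first by rewrite ik.
have ik' : (i < k)%N.
  have := ltn_ord i; rewrite ltnS leq_eqVlt => /orP[/eqP E|//].
  by case/eqP: ik; apply: val_inj.
have -> : i = widen_ord (leqnSn k) (Ordinal ik') by apply: val_inj.
exact: (IH _ _ (Ordinal ik') st).
Qed.

Lemma strainer_orthogonal k (p pbar : 'I_k -> X) (i j : 'I_k) : (j < i)%N ->
  strainer_with B delta x p pbar ->
  \forall y \near x, almost_orthogonal delta (p j) (p i) y /\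
     almost_orthogonal delta (p j) (pbar i) y.
Proof.
elim: k p pbar i j => [|k IH] p pbar i j /=; first by case: i.
move=> ji [st _ [U [xU _ _ _ orth]]].
have jk : (j < k)%N by apply: (leq_trans ji); rewrite -ltnS.
have jE : j = widen_ord (leqnSn k) (Ordinal jk) by apply: val_inj.
have [ik|ik] := eqVneq i ord_max.
  by rewrite ik jE; apply: filterS xU => y /orth /(_ (Ordinal jk)).
have ik' : (i < k)%N.
  have := ltn_ord i; rewrite ltnS leq_eqVlt => /orP[/eqP E|//].
  by case/eqP: ik; apply: val_inj.
have -> : i = widen_ord (leqnSn k) (Ordinal ik') by apply: val_inj.
by rewrite jE; apply: (IH _ _ (Ordinal ik') (Ordinal jk) _ st).
Qed.

Lemma extended_strainer_near k p0 (p : 'I_k -> X) :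
  B x -> extended_strainer B delta x p0 p ->
  B p0 /\ exists pbar : 'I_k -> X,
   (forall i, B (p i) /\ B (pbar i)) /\
   \forall y \near x, [/\ B y, y <> p0 &
     forall i : 'I_k, [/\ y <> p i, y <> pbar i,
       pi - delta < angle (p i) y (pbar i),
       almost_orthogonal delta p0 (p i) y /\
       almost_orthogonal delta p0 (pbar i) y &
       forall j : 'I_k, (j < i)%N -> almost_orthogonal delta (p j) (p i) y /\
       almost_orthogonal delta (p j) (pbar i) y]].
Proof.
move=> Bx [Bp0 [pbar st [U [xU UB Up0 Up orth]]]]; split=> //; exists pbar.
split.
  by move=> i; have [[]] := strainer_opposite i st.
near=> y.
have Uy : U y by near: y.
have nU q : ~ U q -> y <> q by move=> Uq yq; apply: Uq; rewrite -yq.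
split; [exact: UB|exact: nU|].
move=> i; split;
  [apply: nU; exact: (Up i).1|apply: nU; exact: (Up i).2| |exact: orth|].
  move: i; near: y.
  apply: filter_forall => i.
  have [_ [V [xV _ _ _ h]]] := strainer_opposite i st.
  exact: filterS xV.
move: i; near: y; apply: filter_forall => i.
suff : \forall y \near x, forall j : 'I_k, (j < i)%N ==>
     `[< almost_orthogonal delta (p j) (p i) y /\
       almost_orthogonal delta (p j) (pbar i) y >].
  by apply: filterS => y h j ji; apply/asboolP; have := h j; rewrite ji.
apply: filter_forall => j; have [ji|ji] := boolP (j < i)%N => /=.
  by apply: filterS (strainer_orthogonal ji st) => y h; apply/asboolP.
exact: nearW.
Unshelve. all: by end_near. Qed.

End strainers.

Section frame.
Variables (R : realType) (X : metricType R).

(** The metric content of an extended strainer: around x, the effect of moves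
    of length s <= rho on the distances to p_0 and to the p_j, with
    relative error theta.  Moves towards p_i and pbar_i are controlled only on
    the coordinates j <= i, because the angles are not symmetric. *)
Record frame (B : set X) (k : nat) (x p0 : X) (p pbar : 'I_k -> X)
    (rho theta : R) : Prop := Frame {
  frame_p0 : B p0;
  frame_p : forall i, B (p i);
  frame_pbar : forall i, B (pbar i);
  frame_ball : forall z, mdist x z < 2 * rho ->
    [/\ B z, z <> p0 & forall i, z <> p i /\ z <> pbar i];
  frame_base : forall z s, mdist x z < 2 * rho -> 0 <= s <= rho ->
    mdist p0 (toward p0 z s) = mdist p0 z - s;
  frame_toward : forall i z s, mdist x z < 2 * rho -> 0 <= s <= rho ->
    [/\ mdist (p i) (toward (p i) z s) = mdist (p i) z - s,
        `|mdist p0 (toward (p i) z s) - mdist p0 z| <= theta * s &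
        forall j : 'I_k, (j < i)%N ->
        `|mdist (p j) (toward (p i) z s) - mdist (p j) z| <= theta * s];
  frame_away : forall i z s, mdist x z < 2 * rho -> 0 <= s <= rho ->
    [/\ `|mdist (p i) (toward (pbar i) z s) - mdist (p i) z - s| <= theta * s,
        `|mdist p0 (toward (pbar i) z s) - mdist p0 z| <= theta * s &
        forall j : 'I_k, (j < i)%N ->
        `|mdist (p j) (toward (pbar i) z s) - mdist (p j) z| <= theta * s] }.

Lemma almost_orthogonal_cos (delta theta : R) (p q y : X) :
  (forall a : R, `|a| < delta -> 1 - theta <= cos a /\ `|sin a| <= theta) ->
  almost_orthogonal delta p q y -> `|cos (angle p y q)| <= theta.
Proof.
move=> h /h[_]; rewrite -[in cos _](subrK (pi / 2) (angle p y q)).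
by rewrite cosDpihalf normrN.
Qed.

Lemma opposite_cos (delta theta : R) (p q y : X) :
  (forall a : R, `|a| < delta -> 1 - theta <= cos a /\ `|sin a| <= theta) ->
  0 <= angle p y q <= pi ->
  pi - delta < angle p y q -> cos (angle p y q) <= - (1 - theta).
Proof.
move=> h a0 ad; have [] := h (angle p y q - pi).
  by rewrite ler0_norm; lra.
by rewrite cosB cospi sinpi mulr0 addr0 mulrN1; lra.
Qed.

(** All angle conditions hold on a ball of radius 4 rho around x, and all
    strainers lie outside of it; so moves of length at most rho that start
    within 2 rho stay in the region where the angles are controlled and do not
    reach their targets. *)
Lemma strainer_frame (B : set X) (k : nat) (delta theta : R) (x p0 : X)
    (p : 'I_k -> X) :
  busemann_region B -> B x ->
  (forall a : R, `|a| < delta -> 1 - theta <= cos a /\ `|sin a| <= theta) ->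
  extended_strainer B delta x p0 p ->
  exists pbar, exists2 rho, 0 < rho & frame B x p0 p pbar rho theta.
Proof.
move=> HB Bx small ext.
have [Bp0 [pbar [Bpp nearx]]] := extended_strainer_near Bx ext.
exists pbar.
have /metricType_numDomainType.nbhs_mdistP[d /= d0 ballx] := nearx.
exists (d / 4); first lra.
have nearB z : mdist x z < 3 * (d / 4) -> mdist x z < d by lra.
have far q z s : ~ (mdist x q < d) -> mdist x z < 2 * (d / 4) ->
    0 <= s <= d / 4 -> s < mdist z q.
  move=> xq xz sd; have := metric_triangle x z q.
  by move/negP: xq; rewrite -leNgt; lra.
have p0far : ~ (mdist x p0 < d) by move=> /ballx[].
have pfar i : ~ (mdist x (p i) < d) by move=> /ballx[_ _ /(_ i)[]].
have pbarfar i : ~ (mdist x (pbar i) < d) by move=> /ballx[_ _ /(_ i)[]].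
have ends q z s : B q -> mdist x z < 2 * (d / 4) -> 0 <= s <= d / 4 ->
    mdist x z < d /\ mdist x (toward q z s) < d.
  move=> Bq xz sd; have xzd : mdist x z < d by lra.
  split=> //; have [Bz _ _] := ballx _ xzd.
  have := mdist_toward HB Bq Bz (proj1 (andP sd)).
  by have := metric_triangle x z (toward q z s); lra.
have orth r q z s : B r -> B q -> mdist x z < 2 * (d / 4) -> 0 <= s <= d / 4 ->
    ~ (mdist x r < d) -> ~ (mdist x q < d) ->
    (forall y, mdist x y < d -> almost_orthogonal delta r q y) ->
    `|mdist r (toward q z s) - mdist r z| <= theta * s.
  move=> Br Bq xz sd rfar qfar ao.
  have [h1 h2] := ends _ _ _ Bq xz sd.
  have c1 := almost_orthogonal_cos small (ao _ h1).
  have c2 := almost_orthogonal_cos small (ao _ h2).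
  have sq := far _ _ _ qfar xz sd.
  have [Bz _ _] := ballx _ h1.
  have ne y w : mdist x y < d -> ~ (mdist x w < d) -> y <> w.
    by move=> ? + yw; rewrite -yw.
  case/andP: (sd) => s0 _.
  have l1 := toward_slope_ge HB Br Bq Bz (ne _ _ h1 rfar) (ne _ _ h1 qfar)
    s0 (ltW sq).
  have l2 := toward_slope_le HB Br Bq Bz (ne _ _ h1 qfar) s0 sq (ne _ _ h2 rfar).
  move: c1 c2; rewrite !ler_norml => c1 c2.
  have m1 : cos (angle r z q) * s <= theta * s by apply: ler_wpM2r; lra.
  have m2 : - theta * s <= cos (angle r (toward q z s) q) * s.
    by apply: ler_wpM2r; lra.
  by lra.
have self q z s : B q -> ~ (mdist x q < d) -> mdist x z < 2 * (d / 4) ->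
    0 <= s <= d / 4 -> mdist q (toward q z s) = mdist q z - s.
  move=> Bq qfar xz sd; have [h1 _] := ends _ _ _ Bq xz sd.
  have [Bz _ _] := ballx _ h1.
  by apply: (toward_self HB) => //; [lra|exact/ltW/far].
split=> //.
- by move=> i; case: (Bpp i).
- by move=> i; case: (Bpp i).
- move=> z xz; have xzd : mdist x z < d by lra.
  have [Bz zp0 h] := ballx z xzd.
  by split=> // i; case: (h i).
- by move=> z s xz sd; apply: self.
- move=> i z s xz sd; have [Bp Bpb] := Bpp i; split.
  + exact: self.
  + by apply: orth => // y /ballx[_ _ /(_ i)[_ _ _ []]].
  + move=> j ji; have [Bpj _] := Bpp j.
    by apply: orth => // y /ballx[_ _ /(_ i)[_ _ _ _ /(_ j ji)[]]].
- move=> i z s xz sd; have [Bp Bpb] := Bpp i; split.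
  + have [h1 _] := ends _ _ _ Bp xz sd.
    have [Bz _ /(_ i)[zp zpb ang _ _]] := ballx _ h1.
    have [a01 _] := angle_slope HB Bp Bpb Bz zp zpb.
    have c := opposite_cos small a01 ang.
    case/andP: (sd) => s0 _.
    have l1 := toward_slope_ge HB Bp Bpb Bz zp zpb s0
      (ltW (far _ _ _ (pbarfar i) xz sd)).
    have l2 := mdist_toward HB Bpb Bz s0.
    have := metric_triangle (p i) z (toward (pbar i) z s).
    have m : (1 - theta) * s <= - cos (angle (p i) z (pbar i)) * s.
      by apply: ler_wpM2r; lra.
    have th : 0 <= theta * s.
      rewrite mulr_ge0//; have [|_] := small 0; last exact: le_trans.
      by rewrite normr0; lra.
    by rewrite ler_norml; lra.
  + by apply: orth => // y /ballx[_ _ /(_ i)[_ _ _ []]].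
  + move=> j ji; have [Bpj _] := Bpp j.
    by apply: orth => // y /ballx[_ _ /(_ i)[_ _ _ _ /(_ j ji)[]]].
Qed.

End frame.

(** * Distance functions are almost affine along paths issuing from a point *)

Section extension.
Variables (R : realType) (X : metricType R).
Implicit Types (p q x y z : X) (s t : R).
Variables (B : set X) (HB : busemann_region B).

(** Equality in the triangle inequality makes the concatenation of [x, y] and
    [y, z] a shortest path, and shortest paths are unique. *)
Lemma between_geo x y z : B x -> B y -> B z ->
  mdist x z = mdist x y + mdist y z -> x <> z ->
  y = geo x z (mdist x y / mdist x z).
Proof.
move=> Bx By Bz xyz xz.
have L0 : 0 < mdist x z by rewrite mdist_gt0; apply/eqP.
set L := mdist x z in L0 xyz *; set a := mdist x y in xyz *.
set b := mdist y z in xyz.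
have a0 : 0 <= a := mdist_ge0 x y.
have b0 : 0 <= b := mdist_ge0 y z.
pose g t := if t * L <= a then geo x y (t * L / a) else geo y z ((t * L - a) / b).
have par1 t : 0 <= t -> t * L <= a ->
    0 <= t * L / a <= 1 /\ t * L / a * a = t * L.
  move=> t0 ta; have tL : 0 <= t * L by rewrite mulr_ge0// ltW.
  have [az|az] := eqVneq a 0.
    by rewrite az invr0 !mulr0 lexx ler01; split => //; lra.
  have a1 : 0 < a by rewrite lt_neqAle eq_sym az.
  by rewrite ler_pdivrMr// mul1r ta divr_ge0// divfK.
have par2 t : t <= 1 -> a < t * L ->
    0 <= (t * L - a) / b <= 1 /\ (t * L - a) / b * b = t * L - a.
  move=> t1 ta.
  have tL : t * L <= L by rewrite ler_piMl// ltW.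
  have b1 : 0 < b by lra.
  rewrite ler_pdivrMr// mul1r divr_ge0 ?divfK ?gt_eqF//; last lra.
  by split => //; lra.
have glip s t : 0 <= s -> s <= t -> t <= 1 -> mdist (g s) (g t) <= (t - s) * L.
  move=> s0 st t1.
  have sL : s * L <= t * L by rewrite ler_wpM2r// ltW.
  rewrite /g; case: (lerP (t * L) a) => ta; case: (lerP (s * L) a) => sa;
    last 1 first.
  - have [p1 e1] := par2 _ t1 ta; have [|p2 e2] := par2 s _ sa; first lra.
    rewrite (mdist_geoE HB By Bz)// -/b -[X in `|_| * X](ger0_norm b0).
    by rewrite -normrM mulrBl e1 e2 distrC ger0_norm; lra.
  - have [p1 e1] := par1 s s0 sa; have [|p2 e2] := par1 t _ ta; first lra.
    rewrite (mdist_geoE HB Bx By)// -/a -[X in `|_| * X](ger0_norm a0).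
    by rewrite -normrM mulrBl e1 e2 distrC ger0_norm; lra.
  - lra.
  - have [p1 e1] := par1 s s0 sa; have [p2 e2] := par2 t t1 ta.
    have := metric_triangle (geo x y (s * L / a)) y (geo y z ((t * L - a) / b)).
    have [_ ->] := mdist_geo HB Bx By p1; have [-> _] := mdist_geo HB By Bz p2.
    by rewrite -/a -/b; lra.
have aL : a <= L by lra.
have g0 : g 0 = x by rewrite /g mul0r a0 mul0r (geo0 HB).
have g1 : g 1 = z.
  rewrite /g mul1r; case: ifPn => [La|].
    have bz : b = 0 by lra.
    have az : a != 0 by rewrite gt_eqF//; lra.
    have LaE : L = a by lra.
    by rewrite LaE divff// (geo1 HB Bx By); apply: mdist_positivity.
  rewrite -ltNge => aL'; have -> : L - a = b by lra.
  by rewrite divff ?(geo1 HB)// gt_eqF//; lra.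
have sg : segment x z g.
  split=> //.
  have half s t : 0 <= s -> s <= t -> t <= 1 -> mdist (g s) (g t) = (t - s) * L.
    move=> s0 st t1; have h1 := glip _ _ s0 st t1.
    have h2 := glip _ _ (lexx 0) s0 (le_trans st t1).
    have h3 := glip _ _ (le_trans s0 st) t1 (lexx 1).
    have h4 := metric_triangle x (g s) (g t).
    have h5 := metric_triangle x (g t) z.
    rewrite g0 in h2; rewrite g1 in h3; apply/eqP; rewrite eq_le h1/=.
    by rewrite -/L in h5; lra.
  move=> s t /andP[s0 s1] /andP[t0 t1]; have [st|ts] := lerP s t.
    by rewrite half// distrC ger0_norm; lra.
  by rewrite metric_sym half ?(ltW ts)// ger0_norm; lra.
have l01 : 0 <= a / L <= 1 by rewrite ler_pdivrMr// mul1r aL divr_ge0// ltW.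
rewrite -(segment_uniq HB Bx Bz sg l01) /g divfK ?gt_eqF// lexx.
have [az|az] := eqVneq a 0.
  by rewrite az mul0r (geo0 HB)//; apply/esym/mdist_positivity.
by rewrite divff// (geo1 HB).
Qed.

(** A local extension of a shortest path is again a shortest path: the distance
    to x is convex along a short piece of it centered at z and has slope 1
    before z, hence slope 1 after z. *)
Lemma geodesic_extend x z (eps : R) : locally_geodesically_complete X ->
  open B -> B x -> B z -> x <> z -> 0 < eps ->
  (forall y, mdist x y < mdist x z + eps -> B y) ->
  exists y, [/\ 0 < mdist z y, mdist z y < eps &
    mdist x y = mdist x z + mdist z y].
Proof.
move=> lgc oB Bx Bz xz eps0 inB.
have L0 : 0 < mdist x z by rewrite mdist_gt0; apply/eqP.
set L := mdist x z in L0 inB *.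
pose gam t := geo x z (t / L).
have par t : 0 <= t <= L -> 0 <= t / L <= 1.
  by move=> /andP[t0 t1]; rewrite ler_pdivrMr// mul1r t1 divr_ge0// ltW.
have gamE s t : 0 <= s <= L -> 0 <= t <= L -> mdist (gam s) (gam t) = `|s - t|.
  move=> /par ps /par pt; rewrite /gam (mdist_geoE HB Bx Bz)// -mulrBl normrM.
  by rewrite (gtr0_norm (x := _^-1)) ?invr_gt0// divfK// gt_eqF.
have geod : geodesic 0 L gam.
  split.
    apply/subspace_continuousP => t /=; rewrite in_itv/= => tL.
    apply/metricType_numDomainType.cvgrPdist_lt => e e0.
    near=> s.
    have sL : s \in `[0, L] by near: s; exact: withinT.
    rewrite gamE //.
    by near: s; apply: cvg_within; apply: (@cvgr_dist_lt _ _ _ (nbhs t) _ id t).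
  exists 1 => // s t s0 st tL _ u v; rewrite !in_itv/= => u1 v1.
  by apply: gamE; lra.
have [e e0 [h [_ [e' e'0 hs]] hg]] := lgc _ _ _ L0 geod.
pose tau := Num.min (Num.min (e / 2) (eps / 2)) (Num.min (e' / 4) L).
have [t1 t2 t3 t4] : [/\ tau <= e / 2, tau <= eps / 2, tau <= e' / 4 & tau <= L].
  by rewrite /tau !ge_min !lexx ?orbT.
have tau0 : 0 < tau.
  by rewrite /tau !lt_min; apply/andP; split; apply/andP; split; lra.
have LL : L \in `[0, L] by rewrite in_itv/= lexx (ltW L0).
have hz : h L = z by rewrite hg// /gam divff ?gt_eqF// (geo1 HB).
have sp : shortest_path (L - tau) (L + tau) h by apply: hs; lra.
have d1 : mdist z (h (L + tau)) = tau.
  rewrite -hz sp ?in_itv/=; [|lra|lra].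
  by rewrite distrC ger0_norm; lra.
have hL' : h (L - tau) = gam (L - tau) by apply: hg; rewrite in_itv/=; lra.
have d0 : mdist x (h (L - tau)) = L - tau.
  have -> : x = gam 0 by rewrite /gam mul0r (geo0 HB).
  by rewrite hL' gamE ?sub0r ?normrN ?ger0_norm//; lra.
have tri := metric_triangle x z (h (L + tau)).
rewrite d1 -/L in tri.
exists (h (L + tau)); rewrite d1; split => //; first by lra.
have By : B (h (L + tau)) by apply: inB; lra.
have Ba : B (h (L - tau)) by apply: inB; lra.
have sg : segment (h (L - tau)) (h (L + tau))
    (fun u => h (L - tau + u * (2 * tau))).
  have inI u : 0 <= u <= 1 -> L - tau + u * (2 * tau) \in `[L - tau, L + tau].
    move=> /andP[u0 u1]; have h1 : 0 <= u * tau by rewrite mulr_ge0// ltW.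
    have h2 : 0 <= (1 - u) * tau by rewrite mulr_ge0 ?subr_ge0// ltW.
    by rewrite in_itv/=; lra.
  split; rewrite ?mul0r ?addr0 ?mul1r//; first by congr h; lra.
  move=> s t s01 t01; rewrite !sp ?inI//; try by rewrite in_itv/=; lra.
  rewrite (_ : _ - _ = (s - t) * (2 * tau)); last by lra.
  rewrite (_ : L - tau - (L + tau) = - (2 * tau)); last by lra.
  by rewrite normrM normrN.
have half01 : 0 <= (2^-1 : R) <= 1 by lra.
have := segment_convex HB Bx Ba By sg half01.
rewrite (_ : L - tau + 2^-1 * (2 * tau) = L); last by lra.
by rewrite hz d0 -/L; lra.
Unshelve. all: by end_near. Qed.

(** Among the points z of the closed ball with y on [x, z], one at maximal
    distance from x exists by compactness; by [geodesic_extend] it lies on the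
    sphere. *)
Lemma extend_to_sphere x y (r : R) : locally_geodesically_complete X ->
  open B -> B x -> x <> y -> mdist x y <= r ->
  (forall w, mdist x w <= r -> B w) -> compact (metric_cball x r) ->
  exists z, [/\ B z, mdist x z = r & y = geo x z (mdist x y / r)].
Proof.
move=> lgc oB Bx xy yr inB cpt.
pose A := metric_cball x r `&` [set z | mdist x z = mdist x y + mdist y z].
have cA : compact A.
  apply: (subclosed_compact _ cpt); last by move=> z [].
  apply: closedI; first exact: closed_cball.
  rewrite (_ : [set z | _] =
      (fun z => mdist x z - mdist y z) @^-1` [set mdist x y]).
    apply: preimage_closed; last exact: closed_eq.
    by move=> z _; apply: cvgB; exact: mdist_continuous.
  by apply/seteqP; split => z /=; lra.
have A0 : A !=set0 by exists y; split; [exact: yr|rewrite /= mdistxx addr0].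
have [|z] := compact_EVT_max A0 cA (f := mdist x).
  by apply: continuous_subspaceT; exact: mdist_continuous.
rewrite inE => -[zr xyz] zmax.
have Bz : B z by exact: inB.
have xz : x <> z.
  move=> xz; move: xyz => /=; rewrite -xz mdistxx; have := mdist_ge0 y x.
  have : 0 < mdist x y by rewrite mdist_gt0; apply/eqP.
  by lra.
have zrE : mdist x z = r.
  apply/eqP; rewrite eq_le zr/= leNgt; apply/negP => zlt.
  have e0 : 0 < r - mdist x z by lra.
  have [|w [w0 wr xw]] := geodesic_extend lgc oB Bx Bz xz e0.
    by move=> w ww; apply: inB; lra.
  have : mdist x w <= mdist x z.
    apply: zmax; rewrite inE; split; rewrite /metric_cball/=; first lra.
    have := metric_triangle x y w; have := metric_triangle y z w.
    by move: xyz => /=; lra.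
  by lra.
exists z; split => //; rewrite -zrE; apply: between_geo => //.
exact: inB.
Qed.

(** By convexity, the mean slope of d(p, .) on a final piece of [x, y] is at
    most its mean slope between distances |xy| and 2 |xy| on an extension of
    [x, y].  Along each
    path issuing from x both mean slopes, on [0, |xy|] and on [0, 2 |xy|], tend
    to the derivative at x, and by the Busemann inequality the estimate for one
    path persists for the neighboring ones, whence uniformity on the sphere. *)
Lemma uniform_slope x p (r eta : R) : locally_geodesically_complete X ->
  open B -> B x -> B p -> x <> p -> 0 < r -> 0 < eta ->
  (forall w, mdist x w <= r -> B w) -> compact (metric_cball x r) ->
  exists2 r' : R, 0 < r' & forall y t, mdist x y <= r' -> 0 <= t <= 1 ->
    mdist p y - mdist p (geo x y t) <=
      (1 - t) * (mdist p y - mdist p x + 2 * eta * mdist x y).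
Proof.
move=> lgc oB Bx Bp xp r0 eta0 inB cpt.
(* P t z says that the mean slopes of d(p, .) on the first t-th and on the
   first 2t-th of [x, z] differ by at most eta. *)
pose P (t : R) z :=
  mdist p (geo x z (2 * t)) - 2 * mdist p (geo x z t) + mdist p x <=
  2 * t * (eta * r).
have cS : compact (metric_sphere x r).
  apply: (subclosed_compact _ cpt); first exact: closed_sphere.
  by move=> z; rewrite /metric_sphere /metric_cball/= => ->.
have : \forall t \near (0:R)^'+, metric_sphere x r `<=` P t.
  apply: (compact_near_coveringP _).1 cS _ _ _ _ _ => z zr.
  have Bz : B z by apply: inB; rewrite zr.
  have xz : x <> z by move=> xz; move: r0; rewrite -zr -xz mdistxx ltxx.
  have [_ [lo up]] := angle_slope HB Bp Bz Bx xp xz.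
  have eta2 : 0 < eta / 2 by lra.
  have {up}[t0 /andP[t00 t01] up] := up _ eta2.
  set D := - cos _ in lo up.
  near=> z' t.
  have tp : 0 < t by near: t; exact: nbhs_right_gt.
  have tt : t <= t0 / 2 by near: t; apply: nbhs_right_le; lra.
  have zz' : mdist z z' <= eta * r / 4.
    near: z'; apply: metricType_numDomainType.cvgr_dist_le => //.
    by have := mulr_gt0 eta0 r0; lra.
  have Bz' : B z' by near: z'; apply: open_nbhs_nbhs; split.
  have i1 : 0 <= t <= 1 by lra.
  have i2 : 0 <= 2 * t <= 1 by lra.
  have l1 := lo _ i1; have l2 := up (2 * t) (ltac:(lra)).
  rewrite zr in l1 l2.
  have b1 := geo_busemann HB Bx Bz Bx Bz' i1.
  have b2 := geo_busemann HB Bx Bz Bx Bz' i2.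
  rewrite mdistxx mulr0 add0r in b1 b2.
  have n1 := mdist_lip p (geo x z t) (geo x z' t).
  have n2 := mdist_lip p (geo x z (2 * t)) (geo x z' (2 * t)).
  move: n1 n2; rewrite !ler_norml /P => n1 n2.
  have m1 : t * mdist z z' <= t * (eta * r / 4) by rewrite ler_wpM2l// ltW.
  by rewrite /=; lra.
move=> [d /= d0 hd].
exists (Num.min (d * r / 2) (r / 2)).
  by rewrite lt_min !divr_gt0// mulr_gt0.
move=> y t; rewrite le_min => /andP[yd yr] t01.
have [xy|/eqP xy] := eqVneq x y.
  have -> : geo x y t = x.
    apply/esym/mdist_positivity; rewrite -xy.
    by have [-> _] := mdist_geo HB Bx Bx t01; rewrite mdistxx mulr0.
  by rewrite -xy mdistxx mulr0 addr0 subrr mulr0.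
have yr' : mdist x y <= r by lra.
have [z [Bz zr yE]] := extend_to_sphere lgc oB Bx xy yr' inB cpt.
have rho0 : 0 < mdist x y by rewrite mdist_gt0; apply/eqP.
set rho := mdist x y in yd yr yr' yE rho0 *.
pose tau := rho / r; rewrite -/tau in yE.
have tau0 : 0 < tau by rewrite divr_gt0.
have taud : tau <= d / 2 by rewrite ler_pdivrMr//; lra.
have taur : tau <= 1 / 2 by rewrite ler_pdivrMr//; lra.
have /(_ z zr) : metric_sphere x r `<=` P tau.
  apply: hd => //=; rewrite /ball_/= sub0r normrN ger0_norm; lra.
rewrite /P -yE => hP.
have -> : geo x y t = geo x z (t * tau).
  rewrite {1}yE -{1}(geo0 HB Bx Bz) (geo_sub HB Bx Bz)//; [|exact: ltW|lra].
  by rewrite add0r subr0.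
have tt : t * tau <= tau by rewrite ler_piMl ?(ltW tau0)//; lra.
have tt0 : 0 <= t * tau by rewrite mulr_ge0 ?(ltW tau0)//; lra.
have := geo_convex3 HB Bp Bx Bz tt0 tt (_ : tau <= 2 * tau) (_ : 2 * tau <= 1).
move=> /(_ ltac:(lra) ltac:(lra)); rewrite -yE => h3.
have h4 : (1 - t) * tau * mdist p (geo x z (2 * tau)) <= (1 - t) * tau *
    (2 * mdist p y - mdist p x + 2 * tau * (eta * r)).
  by apply: ler_wpM2l; [rewrite mulr_ge0 ?(ltW tau0)//|]; lra.
have trho : rho = tau * r by rewrite /tau divfK// gt_eqF.
rewrite trho; suff : tau * (mdist p y - mdist p (geo x z (t * tau))) <=
    tau * ((1 - t) * (mdist p y - mdist p x + 2 * eta * (tau * r))).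
  by rewrite ler_pM2l.
by lra.
Unshelve. all: by end_near. Qed.

End extension.

(** * Iterating a step that halves the error *)

Section iteration.
Variables (R : realType) (X : metricType R).
Implicit Types (w z l : X).

Lemma geometric_lt (C e : R) : 0 < e -> exists n, C / 2 ^+ n < e.
Proof.
move=> e0.
have : C * 2^-1 ^+ n @[n --> \oo] --> (C * 0 : R).
  by apply: cvgM; [exact: cvg_cst|apply: cvg_expr; rewrite ger0_norm; lra].
rewrite mulr0 => /cvgrPdist_lt /(_ _ e0) [n _ /(_ n (leqnn n))].
rewrite /= sub0r normrN exprVn => h; exists n; apply: le_lt_trans h.
exact: ler_norm.
Qed.

Lemma geometric_le0 (C a : R) : (forall n, a <= C / 2 ^+ n) -> a <= 0.
Proof.
move=> aC; apply/ler_addgt0Pr => e /(geometric_lt C)[n ne].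
by have := aC n; lra.
Qed.

Lemma geometric_limit (K : set X) (u : nat -> X) (C : R) :
  complete_subspace K -> 0 <= C -> (forall n, K (u n)) ->
  (forall n, mdist (u n) (u n.+1) <= C / 2 ^+ n) ->
  exists l, forall n, mdist (u n) l <= 2 * C / 2 ^+ n.
Proof.
move=> cK C0 uK du.
have tail n m :
    mdist (u n) (u (n + m)%N) <= 2 * C / 2 ^+ n - 2 * C / 2 ^+ (n + m).
  elim: m => [|m IH]; first by rewrite addn0 mdistxx subrr.
  rewrite addnS; apply: (le_trans (metric_triangle _ (u (n + m)%N) _)).
  have := du (n + m)%N; rewrite exprS invfM.
  by move: IH; set a := (2 ^+ (n + m))^-1; lra.
have pos n : 0 <= 2 * C / 2 ^+ n by rewrite divr_ge0 ?exprn_ge0// mulr_ge0.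
have tail' n m : (n <= m)%N -> mdist (u n) (u m) <= 2 * C / 2 ^+ n.
  move=> nm; rewrite -(subnKC nm); apply: (le_trans (tail _ _)).
  by have := pos (n + (m - n))%N; lra.
have [||l Kl ul] := cK (u @ \oo).
- by exists 0%N => // n _ /=; exact: uK.
- apply: cauchy_exP => e e0; have [n ne] := geometric_lt (2 * C) e0.
  exists (u n); exists n => // m /= nm; rewrite ballEmdist /=.
  exact: le_lt_trans (tail' _ _ nm) ne.
exists l => n; apply/ler_addgt0Pr => e e0.
move/metricType_numDomainType.cvgrPdist_lt: ul => /(_ e e0) [m _ /(_ (maxn m n))].
rewrite /= leq_maxl => /(_ isT) lu.
have := tail' n (maxn m n) (leq_maxr _ _).
have := metric_triangle (u n) (u (maxn m n)) l.
by rewrite (metric_sym (u (maxn m n)) l); lra.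
Qed.

Variables (P : topologicalType) (K : set X) (S : P -> X -> X)
  (E : P -> X -> R) (N : R) (x : X) (rho : R).
Hypothesis cK : complete_subspace K.
Hypothesis ballK : forall w, mdist x w < rho -> K w.
Hypothesis N0 : 0 <= N.
Hypothesis E0 : forall b w, 0 <= E b w.
Hypothesis Elip : forall b w w', `|E b w - E b w'| <= mdist w w'.
Hypothesis Sstep : forall b w, mdist x w + N * E b w < rho ->
  mdist w (S b w) <= N * E b w /\ E b (S b w) <= E b w / 2.

(** Newton's method in a metric space: a step S b that halves the error E b at
    the cost of a move of length at most N times the error has convergent
    iterates.  The parameter b is the target value, and the limit depends
    continuously on it and on the starting point. *)
Definition halving_limit b z : X :=
  xget z [set l | forall n, mdist (iter n (S b) z) l <= 2 * (N * E b z) / 2 ^+ n].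

Lemma iter_step b z n : mdist x z + 2 * N * E b z < rho ->
  [/\ mdist x (iter n (S b) z) + N * E b (iter n (S b) z) < rho,
      E b (iter n (S b) z) <= E b z / 2 ^+ n &
      mdist (iter n (S b) z) (iter n.+1 (S b) z) <= N * E b z / 2 ^+ n].
Proof.
move=> zr.
have NE0 : 0 <= N * E b z by rewrite mulr_ge0.
suff [h1 h2] : mdist x (iter n (S b) z) <=
    mdist x z + 2 * (N * E b z) * (1 - (2 ^+ n)^-1) /\
    E b (iter n (S b) z) <= E b z / 2 ^+ n.
  have h3 : N * E b (iter n (S b) z) <= N * E b z / 2 ^+ n.
    by rewrite -mulrA ler_wpM2l.
  have p : 0 <= N * E b z / 2 ^+ n by rewrite divr_ge0// exprn_ge0.
  have h4 : mdist x (iter n (S b) z) + N * E b (iter n (S b) z) < rho by lra.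
  by split=> //=; apply: (le_trans (Sstep h4).1).
elim: n => [|n [h1 h2]] /=; first by rewrite expr0 invr1 subrr mulr0 addr0 mulr1.
have h3 : N * E b (iter n (S b) z) <= N * E b z / 2 ^+ n.
  by rewrite -mulrA ler_wpM2l.
have p : 0 <= N * E b z / 2 ^+ n by rewrite divr_ge0// exprn_ge0.
have h4 : mdist x (iter n (S b) z) + N * E b (iter n (S b) z) < rho by lra.
have [s1 s2] := Sstep h4.
rewrite exprS invfM; split; last by move: h2 s2; set a := (2 ^+ n)^-1; lra.
have := metric_triangle x (iter n (S b) z) (S b (iter n (S b) z)).
by move: h3 h1; set a := (2 ^+ n)^-1; lra.
Qed.

Lemma halving_limitP b z n : mdist x z + 2 * N * E b z < rho ->
  mdist (iter n (S b) z) (halving_limit b z) <= 2 * (N * E b z) / 2 ^+ n.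
Proof.
move=> zr; rewrite /halving_limit; case: xgetP => [l -> //|/=].
have [l hl] := @geometric_limit K (fun n => iter n (S b) z) (N * E b z) cK
  (mulr_ge0 N0 (E0 b z)) (fun n => ltac:(have [h _ _] := iter_step n zr;
   apply: ballK; apply: le_lt_trans h; rewrite lerDl mulr_ge0//))
  (fun n => ltac:(by have [_ _] := iter_step n zr)).
by move=> /(_ l).
Qed.

Lemma mdist_halving_limit b z : mdist x z + 2 * N * E b z < rho ->
  mdist z (halving_limit b z) <= 2 * N * E b z.
Proof. by move/(@halving_limitP _ _ 0%N); rewrite expr0 divr1 mulrA. Qed.

Lemma halving_limit_err b z : mdist x z + 2 * N * E b z < rho ->
  E b (halving_limit b z) = 0.
Proof.
move=> zr; apply/eqP; rewrite eq_le E0 andbT.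
apply: (@geometric_le0 (E b z + 2 * (N * E b z))) => n.
have [_ h _] := iter_step n zr; have := halving_limitP n zr.
have := Elip b (halving_limit b z) (iter n (S b) z).
by rewrite (metric_sym (halving_limit b z)) ler_norml; lra.
Qed.

Lemma halving_limit_bound (psi : X -> R) (c : R) b z : 0 <= c ->
  (forall w w', `|psi w - psi w'| <= mdist w w') ->
  (forall w, mdist x w + N * E b w < rho -> psi (S b w) <= psi w + c * E b w) ->
  mdist x z + 2 * N * E b z < rho ->
  psi (halving_limit b z) <= psi z + 2 * c * E b z.
Proof.
move=> c0 psilip psiS zr.
have hn n : psi (iter n (S b) z) <= psi z + 2 * c * E b z * (1 - (2 ^+ n)^-1).
  elim: n => [|n IH] /=; first by rewrite expr0 invr1 subrr mulr0 addr0.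
  have [h1 h2 _] := iter_step n zr.
  have := psiS _ h1; rewrite exprS invfM.
  have := ler_wpM2l c0 h2.
  by move: IH; set a := (2 ^+ n)^-1; lra.
rewrite -subr_le0; apply: (@geometric_le0 (2 * (N * E b z))) => n.
have := halving_limitP n zr; have := hn n.
have := psilip (halving_limit b z) (iter n (S b) z).
rewrite (metric_sym (halving_limit b z)) ler_norml.
have : 0 <= 2 * c * E b z / 2 ^+ n by rewrite divr_ge0 ?exprn_ge0// !mulr_ge0.
by lra.
Qed.

Hypothesis Scvg : forall (T : Type) (F : set_system T) (b_ : T -> P)
  (w_ : T -> X) b w, Filter F -> mdist x w + N * E b w < rho ->
  b_ @ F --> b -> w_ @ F --> w -> S (b_ t) (w_ t) @[t --> F] --> S b w.
Hypothesis Ecvg : forall (T : Type) (F : set_system T) (b_ : T -> P)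
  (w_ : T -> X) b w, Filter F ->
  b_ @ F --> b -> w_ @ F --> w -> E (b_ t) (w_ t) @[t --> F] --> E b w.

(** The iterates are continuous and converge at a geometric rate that is
    locally uniform, since E is continuous. *)
Lemma cvg_halving_limit (T : Type) (F : set_system T) (b_ : T -> P)
    (z_ : T -> X) b z : Filter F -> mdist x z + 2 * N * E b z < rho ->
  b_ @ F --> b -> z_ @ F --> z ->
  halving_limit (b_ t) (z_ t) @[t --> F] --> halving_limit b z.
Proof.
move=> FF zr bb zz.
have itc n : iter n (S (b_ t)) (z_ t) @[t --> F] --> iter n (S b) z.
  elim: n => [//|n IH] /=; have [h _ _] := iter_step n zr.
  exact: Scvg.
have EE := Ecvg FF bb zz.
have xz : mdist x (z_ t) + 2 * N * E (b_ t) (z_ t) @[t --> F] -->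
    mdist x z + 2 * N * E b z.
  apply: cvgD; first by apply: cvg_mdist => //; exact: cvg_cst.
  by apply: cvgM => //; exact: cvg_cst.
apply/metricType_numDomainType.cvgrPdist_le => e e0.
have e3 : 0 < e / 3 by lra.
have [n ne] := geometric_lt (2 * (N * (E b z + 1))) e3.
near=> t.
have h1 : mdist x (z_ t) + 2 * N * E (b_ t) (z_ t) < rho.
  by near: t; apply: (cvgr_lt (mdist x z + 2 * N * E b z)).
have h2 : E (b_ t) (z_ t) <= E b z + 1.
  by near: t; apply: (cvgr_le (E b z)) => //; lra.
have h3 : mdist (iter n (S b) z) (iter n (S (b_ t)) (z_ t)) <= e / 3.
  by near: t; apply: (metricType_numDomainType.cvgr_dist_le (itc n)).
have l1 := halving_limitP n zr; have l2 := halving_limitP n h1.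
have p : 0 <= (2 ^+ n : R)^-1 by rewrite invr_ge0 exprn_ge0.
have m1 : 2 * (N * E b z) / 2 ^+ n <= 2 * (N * (E b z + 1)) / 2 ^+ n.
  by rewrite ler_wpM2r// ler_wpM2l// ler_wpM2l//; lra.
have m2 : 2 * (N * E (b_ t) (z_ t)) / 2 ^+ n <= 2 * (N * (E b z + 1)) / 2 ^+ n.
  by rewrite ler_wpM2r// ler_wpM2l// ler_wpM2l//; lra.
have t1 := metric_triangle (halving_limit b z) (iter n (S b) z)
  (halving_limit (b_ t) (z_ t)).
have t2 := metric_triangle (iter n (S b) z) (iter n (S (b_ t)) (z_ t))
  (halving_limit (b_ t) (z_ t)).
by rewrite (metric_sym (halving_limit b z) (iter n (S b) z)) in t1; lra.
Unshelve. all: by end_near. Qed.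

End iteration.

(** * Correcting the coordinates *)

Section coordinates.
Variables (R : realType) (k : nat).
Implicit Types (v : 'rV[R]_k).

Lemma row_norm_le v (e : R) : 0 <= e -> (forall i, `|v 0 i| <= e) -> `|v| <= e.
Proof.
move=> e0 h; rewrite [leLHS]/Num.norm /= mx_normrE.
by apply/bigmax_leP; split=> //= -[a b] _; rewrite /= (ord1 a).
Qed.

Lemma row_norm_ge v i : `|v 0 i| <= `|v|.
Proof.
rewrite [leRHS]/Num.norm /= mx_normrE.
by apply/bigmax_geP; right => /=; exists (0, i).
Qed.

Variable X : metricType R.
Implicit Types (w z : X).
Definition coordinates (p : 'I_k -> X) z : 'rV[R]_k := \row_i mdist (p i) z.

Lemma coordinates_lip p z w :
  `|coordinates p z - coordinates p w| <= mdist z w.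
Proof.
by apply: row_norm_le => [|i]; rewrite ?mdist_ge0// !mxE mdist_lip.
Qed.

Lemma cvg_coordinates (T : Type) (F : set_system T) (p : 'I_k -> X)
    (z_ : T -> X) z : Filter F -> z_ @ F --> z ->
  coordinates p (z_ t) @[t --> F] --> coordinates p z.
Proof.
move=> FF zz; apply/cvgrPdist_lt => e e0.
move/metricType_numDomainType.cvgrPdist_lt: zz => /(_ e e0).
by apply: filterS => t; apply: le_lt_trans; exact: coordinates_lip.
Qed.

Lemma cvg_coord (T : Type) (F : set_system T) (b_ : T -> 'rV[R]_k)
    (b : 'rV[R]_k) i : Filter F -> b_ @ F --> b -> b_ t 0 i @[t --> F] --> b 0 i.
Proof.
move=> FF bb; apply/cvgrPdist_lt => e e0.
move/cvgrPdist_lt: bb => /(_ e e0).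
apply: filterS => t; apply: le_lt_trans.
by have := row_norm_ge (b - b_ t) i; rewrite !mxE.
Qed.

End coordinates.

Section correction.
Variables (R : realType) (X : metricType R).
Variables (B K : set X) (k : nat) (x p0 : X) (p pbar : 'I_k -> X)
  (rho theta : R).
Hypotheses (HB : busemann_region B) (oB : open B).
Hypotheses (cK : complete_subspace K) (BK : B `<=` K).
Hypothesis fr : frame B x p0 p pbar rho theta.
Hypotheses (rho0 : 0 < rho) (theta0 : 0 <= theta).
Hypothesis theta_small : 4 * (theta * 2 ^+ k) <= 1.
Implicit Types (w z : X) (b : 'rV[R]_k) (s t u : R).

Let Bp := frame_p fr.
Let Bpb := frame_pbar fr.

(** Changes d_i by about u: at most one of the two moves is nontrivial, towards
    p_i if u < 0 and towards pbar_i if u > 0. *)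
Definition shift i w u : X := toward (pbar i) (toward (p i) w (- u)) u.

Lemma shift_spec i w u : mdist x w < 2 * rho -> `|u| <= rho ->
  [/\ mdist w (shift i w u) <= `|u|,
      `|mdist (p i) (shift i w u) - mdist (p i) w - u| <= theta * `|u|,
      `|mdist p0 (shift i w u) - mdist p0 w| <= theta * `|u| &
      forall j : 'I_k, (j < i)%N ->
      `|mdist (p j) (shift i w u) - mdist (p j) w| <= theta * `|u|].
Proof.
move=> xw ur; have [Bw _ _] := frame_ball fr xw.
rewrite /shift; have [u0|u0] := lerP 0 u.
  rewrite (ger0_norm u0) in ur *.
  have ur' : 0 <= u <= rho by lra.
  rewrite (toward_le0 HB (Bp i) Bw); last by lra.
  have [h1 h2 h3] := frame_away fr i xw ur'.
  by split=> //; exact: (mdist_toward HB (Bpb i) Bw).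
rewrite (ltr0_norm u0) in ur *.
have ur' : 0 <= - u <= rho by lra.
have Bw' := toward_in HB (- u) (Bp i) Bw.
rewrite (toward_le0 HB (Bpb i) Bw'); last by lra.
have [h1 h2 h3] := frame_toward fr i xw ur'.
split=> //.
  by apply: (mdist_toward HB (Bp i) Bw); lra.
rewrite h1 (_ : _ - _ = 0); last by lra.
by rewrite normr0 mulr_ge0//; lra.
Qed.

Lemma cvg_shift (T : Type) (F : set_system T) i (w_ : T -> X) (u_ : T -> R)
    w u : Filter F -> mdist x w < rho -> `|u| <= rho ->
  w_ @ F --> w -> u_ @ F --> u ->
  shift i (w_ t) (u_ t) @[t --> F] --> shift i w u.
Proof.
have r0 := rho0.
move=> FF xw ur ww uu.
have xw2 : mdist x w < 2 * rho by lra.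
have [Bw _ /(_ i)[wp wpb]] := frame_ball fr xw2.
have dw : mdist w (toward (p i) w (- u)) <= rho.
  have [u0|u0] := lerP (- u) 0.
    by rewrite (toward_le0 HB (Bp i) Bw)// mdistxx; lra.
  have := mdist_toward HB (Bp i) Bw (ltW u0).
  by move: ur; rewrite ler_norml; lra.
have xw' : mdist x (toward (p i) w (- u)) < 2 * rho.
  by have := metric_triangle x w (toward (p i) w (- u)); lra.
have [Bw' _ /(_ i)[_ w'pb]] := frame_ball fr xw'.
rewrite /shift; apply: (cvg_toward HB) => //.
by apply: (cvg_toward HB) => //; exact: cvgN.
Qed.

(** The recursion is on natural numbers so that partial sweeps can be estimated
    by induction; insub succeeds at every step when n <= k. *)
Fixpoint sweep (n : nat) b w : X :=
  if n is m.+1 then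
    let w' := sweep m b w in
    if insub m is Some i then shift i w' (b 0 i - mdist (p i) w') else w'
  else w.

Definition err b w : R := `|b - coordinates p w|.

Lemma err_coord b w i : `|b 0 i - mdist (p i) w| <= err b w.
Proof. by have := row_norm_ge (b - coordinates p w) i; rewrite !mxE. Qed.

Lemma err_lip b w w' : `|err b w - err b w'| <= mdist w w'.
Proof.
apply: (le_trans (ler_dist_dist _ _)).
have -> : b - coordinates p w - (b - coordinates p w') =
  - (coordinates p w - coordinates p w') by apply/rowP => i; rewrite !mxE; ring.
by rewrite normrN coordinates_lip.
Qed.

(** The j-th adjustment has length at most 2^j times the initial error, since
    each coordinate is disturbed by no more than the total length of the
    previous moves.  Once adjusted, a coordinate is only disturbed by the
    factor theta. *)
Lemma sweep_spec n b w : (n <= k)%N -> mdist x w + 2 ^+ k * err b w < rho ->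
  [/\ mdist w (sweep n b w) <= (2 ^+ n - 1) * err b w,
      `|mdist p0 (sweep n b w) - mdist p0 w| <= theta * ((2 ^+ n - 1) * err b w) &
      forall j : 'I_k, (j < n)%N -> `|mdist (p j) (sweep n b w) - b 0 j| <=
         theta * ((2 ^+ n - 1) * err b w)].
Proof.
have r0 := rho0.
move=> nk xw; have e0 : 0 <= err b w by exact: normr_ge0.
elim: n nk => [_|n IH nk] /=.
  by rewrite expr0 subrr mul0r mulr0 mdistxx subrr normr0.
have [h1 h2 h3] := IH (ltnW nk).
rewrite insubT; set i := Sub n nk; set w' := sweep n b w in h1 h2 h3 *.
set u := b 0 i - mdist (p i) w'.
have pk : (2 ^+ n.+1 : R) <= 2 ^+ k by rewrite ler_weXn2l//; lra.
have pk1 : 2 ^+ n.+1 * err b w <= 2 ^+ k * err b w by rewrite ler_wpM2r.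
rewrite exprS in pk1 *.
have p1 : (1 : R) <= 2 ^+ n by rewrite exprn_ege1//; lra.
have p1e : err b w <= 2 ^+ n * err b w by rewrite ler_peMl.
have ub : `|u| <= 2 ^+ n * err b w.
  have := err_coord b w i; have := mdist_lip (p i) w w'.
  by rewrite /u !ler_norml; lra.
have xw' : mdist x w' < 2 * rho by have := metric_triangle x w w'; lra.
have ur : `|u| <= rho by have := mdist_ge0 x w; lra.
have [m1 m2 m3 m4] := shift_spec i xw' ur.
have tu : theta * `|u| <= theta * (2 ^+ n * err b w) by rewrite ler_wpM2l.
set w'' := shift i w' u in m1 m2 m3 m4 *.
split.
- by have := metric_triangle w w' w''; lra.
- by move: m3 h2; rewrite !ler_norml; lra.
- move=> j; rewrite ltnS leq_eqVlt => /orP[/eqP jn|jn].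
    have -> : j = i by apply: val_inj.
    have e1 : 0 <= theta * ((2 ^+ n - 1) * err b w).
      by rewrite !mulr_ge0// subr_ge0.
    by move: m2; rewrite /u !ler_norml; lra.
  by have := h3 _ jn; move: (m4 j jn); rewrite !ler_norml; lra.
Qed.

Lemma cvg_err (T : Type) (F : set_system T) (b_ : T -> 'rV[R]_k)
    (w_ : T -> X) b w : Filter F -> b_ @ F --> b -> w_ @ F --> w ->
  err (b_ t) (w_ t) @[t --> F] --> err b w.
Proof.
by move=> FF bb ww; apply: cvg_norm; apply: cvgB => //; exact: cvg_coordinates.
Qed.

Lemma cvg_sweep n (T : Type) (F : set_system T) (b_ : T -> 'rV[R]_k)
    (w_ : T -> X) b w : Filter F -> (n <= k)%N ->
  mdist x w + 2 ^+ k * err b w < rho -> b_ @ F --> b -> w_ @ F --> w ->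
  sweep n (b_ t) (w_ t) @[t --> F] --> sweep n b w.
Proof.
move=> FF nk xw bb ww; have e0 : 0 <= err b w by exact: normr_ge0.
elim: n nk => [//|n IH nk] /=; have {}IH := IH (ltnW nk).
rewrite insubT; set i := Sub n nk.
have [h1 _ _] := sweep_spec (ltnW nk) xw.
have pk : (2 ^+ n.+1 : R) <= 2 ^+ k by rewrite ler_weXn2l//; lra.
have pk1 : 2 ^+ n.+1 * err b w <= 2 ^+ k * err b w by rewrite ler_wpM2r.
rewrite exprS in pk1.
have p1 : (1 : R) <= 2 ^+ n by rewrite exprn_ege1//; lra.
have p1e : err b w <= 2 ^+ n * err b w by rewrite ler_peMl.
apply: cvg_shift => //.
- by have := metric_triangle x w (sweep n b w); lra.
- have := err_coord b w i; have := mdist_lip (p i) w (sweep n b w).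
  by have := mdist_ge0 x w; rewrite !ler_norml; lra.
- apply: cvgB; first exact: cvg_coord.
  by apply: cvg_mdist => //; exact: cvg_cst.
Qed.

Lemma sweep_halves b w : mdist x w + 2 ^+ k * err b w < rho ->
  mdist w (sweep k b w) <= 2 ^+ k * err b w /\
  err b (sweep k b w) <= err b w / 2.
Proof.
move=> xw; have e0 : 0 <= err b w by exact: normr_ge0.
have [h1 _ h3] := sweep_spec (leqnn k) xw.
have pe : theta * ((2 ^+ k - 1) * err b w) <= err b w / 2.
  have h : 4 * (theta * 2 ^+ k) * err b w <= 1 * err b w by rewrite ler_wpM2r.
  have := mulr_ge0 theta0 e0; lra.
split; first by lra.
apply: row_norm_le => [|i]; first lra.
by rewrite !mxE distrC; apply: le_trans (h3 i (ltn_ord i)) pe.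
Qed.

(** The preliminary move towards p_0 lowers d_0 by the initial error, which
    bounds what the iteration can add to d_0. *)
Definition correct b z : X :=
  halving_limit (sweep k) err (2 ^+ k) b (toward p0 z (err b z)).

(** The preliminary move has length e, the initial error, and at most doubles
    the error; the iteration then costs at most 2 * 2^k * (2 e). *)
Definition correction_factor : R := 1 + 4 * 2 ^+ k.

Lemma correct_premove b z : mdist x z + correction_factor * err b z < rho ->
  let z' := toward p0 z (err b z) in
  [/\ mdist z z' <= err b z, err b z' <= 2 * err b z,
      mdist x z' + 2 * 2 ^+ k * err b z' < rho &
      mdist p0 z' = mdist p0 z - err b z].
Proof.
have r0 := rho0.
rewrite /correction_factor /= => xz; have e0 : 0 <= err b z by exact: normr_ge0.
have pe : 0 <= 2 ^+ k * err b z by rewrite mulr_ge0// exprn_ge0.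
have xz2 : mdist x z < 2 * rho by lra.
have [Bz _ _] := frame_ball fr xz2.
have er : 0 <= err b z <= rho by have := mdist_ge0 x z; lra.
have h1 := mdist_toward HB (frame_p0 fr) Bz e0.
set z' := toward p0 z (err b z) in h1 *.
have h2 : err b z' <= 2 * err b z.
  by have := err_lip b z z'; rewrite ler_norml; lra.
split=> //; last exact: (frame_base fr).
have : 2 ^+ k * err b z' <= 2 ^+ k * (2 * err b z).
  by rewrite ler_wpM2l// exprn_ge0.
by have := metric_triangle x z z'; lra.
Qed.

Let ballK w : mdist x w < rho -> K w.
Proof.
have r0 := rho0; move=> xw; apply: BK.
by have [|//] := frame_ball fr (z := w); lra.
Qed.

Lemma correctP b z : mdist x z + correction_factor * err b z < rho ->
  [/\ coordinates p (correct b z) = b,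
      mdist z (correct b z) <= correction_factor * err b z &
      mdist p0 (correct b z) <= mdist p0 z].
Proof.
move=> xz; have e0 : 0 <= err b z by exact: normr_ge0.
have [h1 h2 h3 h4] := correct_premove xz.
set z' := toward p0 z (err b z) in h1 h2 h3 h4.
have N0 : 0 <= (2 ^+ k : R) by rewrite exprn_ge0.
have E0 b' w : 0 <= err b' w by exact: normr_ge0.
split.
- have := halving_limit_err cK ballK N0 E0 err_lip sweep_halves h3.
  move=> /eqP; rewrite /err normr_eq0 subr_eq0 => /eqP h.
  exact/esym.
- have := mdist_halving_limit cK ballK N0 E0 sweep_halves h3.
  have : 2 ^+ k * err b z' <= 2 ^+ k * (2 * err b z).
    by rewrite ler_wpM2l// exprn_ge0.
  have := metric_triangle z z' (correct b z).
  by rewrite /correct -/z' /correction_factor; lra.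
- have c0 : 0 <= theta * 2 ^+ k by rewrite mulr_ge0.
  have step w : mdist x w + 2 ^+ k * err b w < rho ->
      mdist p0 (sweep k b w) <= mdist p0 w + theta * 2 ^+ k * err b w.
    move=> xw; have [_ + _] := sweep_spec (leqnn k) xw.
    have := mulr_ge0 theta0 (E0 b w).
    by rewrite ler_norml; lra.
  have := @halving_limit_bound _ _ _ K (sweep k) err (2 ^+ k) x rho cK ballK N0 E0
    sweep_halves (mdist p0) _ b z' c0 (mdist_lip p0) step h3.
  have : theta * 2 ^+ k * err b z' <= theta * 2 ^+ k * (2 * err b z).
    by rewrite ler_wpM2l.
  have h : 4 * (theta * 2 ^+ k) * err b z <= 1 * err b z by rewrite ler_wpM2r.
  by rewrite /correct -/z' h4; lra.
Qed.

Lemma cvg_correct (T : Type) (F : set_system T) (b_ : T -> 'rV[R]_k)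
    (z_ : T -> X) b z : Filter F -> mdist x z + correction_factor * err b z < rho ->
  b_ @ F --> b -> z_ @ F --> z ->
  correct (b_ t) (z_ t) @[t --> F] --> correct b z.
Proof.
have r0 := rho0.
move=> FF xz bb zz; have e0 : 0 <= err b z by exact: normr_ge0.
have [h1 h2 h3 h4] := correct_premove xz.
have N0 : 0 <= (2 ^+ k : R) by rewrite exprn_ge0.
have E0 b' w : 0 <= err b' w by exact: normr_ge0.
apply: (cvg_halving_limit cK ballK N0 E0 sweep_halves) => //.
- by move=> *; exact: cvg_sweep.
- by move=> *; exact: cvg_err.
have sp : 0 <= correction_factor.
  by rewrite /correction_factor; have := exprn_ge0 k (ler0n R 2); lra.
have xz2 : mdist x z < 2 * rho by have := mulr_ge0 sp e0; lra.
have [Bz zp0 _] := frame_ball fr xz2.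
by apply: (cvg_toward HB) => //; [exact: (frame_p0 fr)|exact: cvg_err].
Qed.

End correction.

(** * Fibrations from a transport map *)

Section subtypes.
Variables (T : topologicalType).
Implicit Types (V : set T).

Lemma cvg_set_type V (I : Type) (F : set_system I) (g : I -> set_type V)
    (a : set_type V) : Filter F ->
  set_val (g i) @[i --> F] --> (set_val a : T) -> g @ F --> a.
Proof.
move=> FF ga U [_ [[W oW <-] /= Wa WU]].
have : nbhs (set_val a) W by apply: open_nbhs_nbhs.
by move=> /ga; rewrite /nbhs/=; apply: filterS => i Wi; exact: WU.
Qed.

Lemma cvg_set_val V (I : Type) (F : set_system I) (g : I -> set_type V)
    (a : set_type V) : Filter F ->
  g @ F --> a -> set_val (g i) @[i --> F] --> (set_val a : T).
Proof.
move=> FF ga; apply: cvg_comp ga _.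
exact: (@initial_continuous _ _ (@set_val T V)).
Qed.

(** Continuity of h is expressed along arbitrary filters on the ambient space,
    so that it can be checked without passing to the subspace V. *)
Lemma contractible_set (R : realType) V (h : T -> R -> T) (a : T) : V a ->
  (forall y t, V y -> 0 <= t <= 1 -> V (h y t)) ->
  (forall (I : Type) (F : set_system I) (y_ : I -> T) (t_ : I -> R)
      (y : T) (t : R),
    Filter F -> V y -> 0 <= t <= 1 -> y_ @ F --> y -> t_ @ F --> t ->
    h (y_ i) (t_ i) @[i --> F] --> h y t) ->
  (forall y, V y -> h y 0 = y) -> (forall y, V y -> h y 1 = a) ->
  contractible R (set_type V).
Proof.
move=> Va hV hc h0 h1.
have hV' (yt : set_type V * R) : V (h (set_val yt.1) (clamp yt.2)).
  by apply: hV; [exact: set_valP|exact: clamp01].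
exists (SigSub (mem_set Va)), (fun yt => SigSub (mem_set (hV' yt))); split.
- apply/subspace_continuousP => -[y t] [_ /=]; rewrite in_itv/= => t01.
  apply: cvg_set_type => /=.
  have -> : set_val (SigSub (mem_set (hV' (y, t)))) = h (set_val y) t.
    by rewrite /set_val/= clamp_id.
  apply: (@cvg_trans _ (h (set_val yt.1) yt.2
      @[yt --> within ([set: set_type V] `*` `[0, 1]) (nbhs (y, t))])).
    apply: near_eq_cvg; near=> yt.
    have [_ /=] : ([set: set_type V] `*` `[0, 1]%classic) yt.
      by near: yt; exact: withinT.
    by rewrite in_itv/= => yt01; rewrite /set_val/= clamp_id.
  apply: hc => //.
  + exact: set_valP.
  + by apply: cvg_set_val; apply: cvg_within_filter; exact: cvg_fst.
  + by apply: cvg_within_filter; exact: cvg_snd.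
- move=> y; apply: val_inj => /=; rewrite clamp_id ?lexx ?ler01// h0//.
  exact: set_valP.
- move=> y; apply: val_inj => /=; rewrite clamp_id ?lexx ?ler01// h1//.
  exact: set_valP.
Unshelve. all: by end_near. Qed.

End subtypes.

Section transport.
Variables (R : realType) (T S : topologicalType).
Variables (V : set T) (f : T -> S) (tau : T -> S -> T).
Hypothesis fc : forall y, V y -> f @ within V (nbhs y) --> f y.
Hypothesis tauV : forall y b, V y -> (f @` V) b -> V (tau y b) /\ f (tau y b) = b.
Hypothesis tau_id : forall y, V y -> tau y (f y) = y.
Hypothesis tau_cvg : forall (I : Type) (F : set_system I) (y_ : I -> T)
    (b_ : I -> S) (y : T) (b : S),
  Filter F -> V y -> (f @` V) b -> y_ @ F --> y -> b_ @ F --> b ->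
  tau (y_ i) (b_ i) @[i --> F] --> tau y b.

(** The lift of a homotopy H starting at f o h transports h(z) to the fiber of
    H(z, t). *)
Lemma transport_hurewicz : hurewicz_fibration R (@onto_image _ _ f V).
Proof.
split.
- move=> y; apply: cvg_set_type; first exact: nbhs_filter.
  have Vy := set_valP y.
  have yy : set_val y' @[y' --> nbhs y] --> within V (nbhs (set_val y)).
    move=> U /(@initial_continuous _ _ (@set_val T V) y).
    apply: (@filterS _ (nbhs y) (nbhs_filter y)) => y' h.
    by apply: h; exact: set_valP.
  exact: cvg_comp yy (fc Vy).
- move=> [b bV]; have [y Vy yb] := set_mem bV.
  by exists (SigSub (mem_set Vy)); apply: val_inj; rewrite /= -yb.
- move=> Z h H hc Hc Hh.
  have tV zt : V (tau (set_val (h zt.1)) (set_val (H zt))).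
    by apply: (tauV _ _).1; exact: set_valP.
  exists (fun zt => SigSub (mem_set (tV zt))); split.
  + apply/subspace_continuousP => -[z t] zt; apply: cvg_set_type => /=.
    apply: tau_cvg; [exact: set_valP|exact: set_valP| |].
      apply: cvg_set_val; apply: cvg_within_filter.
      by apply: (@cvg_comp _ _ _ fst h _ (nbhs z)); [exact: cvg_fst|exact: hc].
    apply: cvg_set_val.
    by move/subspace_continuousP: Hc; apply.
  + move=> z; apply: val_inj => /=; rewrite Hh/=.
    by rewrite /set_val/= tau_id//; exact: set_valP.
  + move=> z t _; apply: val_inj => /=.
    by rewrite (tauV _ _).2//; exact: set_valP.
Qed.

(** Transporting a contraction h of V back to the fiber of w contracts this
    fiber. *)
Lemma transport_fiber (h : T -> R -> T) (a : T) (w : S) : V a ->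
  (forall y t, V y -> 0 <= t <= 1 -> V (h y t)) ->
  (forall (I : Type) (F : set_system I) (y_ : I -> T) (t_ : I -> R)
      (y : T) (t : R),
    Filter F -> V y -> 0 <= t <= 1 -> y_ @ F --> y -> t_ @ F --> t ->
    h (y_ i) (t_ i) @[i --> F] --> h y t) ->
  (forall y, V y -> h y 0 = y) -> (forall y, V y -> h y 1 = a) ->
  (f @` V) w -> contractible R (set_type (V `&` f @^-1` [set w])).
Proof.
move=> Va hV hc h0 h1 Vw.
apply: (@contractible_set _ _ _ (fun y t => tau (h y t) w) (tau a w)).
- exact: tauV.
- by move=> y t [Vy _] t01; apply: tauV => //; exact: hV.
- move=> I F y_ t_ y t FF [Vy _] t01 yy tt; apply: tau_cvg => //.
  + exact: hV.
  + exact: hc.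
  + exact: cvg_cst.
- by move=> y [Vy /= <-]; rewrite h0// tau_id.
- by move=> y [Vy _]; rewrite h1.
Qed.

End transport.

(** * The neighborhood and its fibers *)

Section neighborhood.
Variables (R : realType) (X : metricType R).
Variables (B : set X) (k : nat) (x p0 : X) (p : 'I_k -> X).
Implicit Types (w y z : X) (b : 'rV[R]_k) (s t u : R).
Local Notation F := (coordinates p).

(* fixc stands for [correct], of which only the estimates matter here. *)
Variables (C rho r : R) (fixc : 'rV[R]_k -> X -> X).
Hypotheses (HB : busemann_region B) (oB : open B).
Hypotheses (Bx : B x) (Bp0 : B p0) (Bp : forall i, B (p i)).
Hypothesis C1 : 1 <= C.
Hypotheses (r0 : 0 < r) (rrho : 4 * r <= rho).
Hypothesis rB : forall y, mdist x y < r -> B y.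
Hypothesis fixP : forall b z, mdist x z + C * err p b z < rho ->
  [/\ F (fixc b z) = b, mdist z (fixc b z) <= C * err p b z &
      mdist p0 (fixc b z) <= mdist p0 z].
Hypothesis fix_cvg : forall (T : Type) (G : set_system T)
  (b_ : T -> 'rV[R]_k) (z_ : T -> X) b z, Filter G ->
  mdist x z + C * err p b z < rho -> b_ @ G --> b -> z_ @ G --> z ->
  fixc (b_ t) (z_ t) @[t --> G] --> fixc b z.
Hypothesis slope : forall i y t, mdist x y < r -> 0 <= t <= 1 ->
  mdist (p i) y - mdist (p i) (geo x y t) <=
  (1 - t) * (mdist (p i) y - mdist (p i) x + 2 * (8 * C)^-1 * mdist x y).

Let eps := r / (16 * C).

Let epsE : 16 * (C * eps) = r.
Proof. by have c1 := C1; rewrite /eps; field; lra. Qed.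

Let eps0 : 0 < eps.
Proof. by have c1 := C1; have r1 := r0; rewrite divr_gt0// mulr_gt0//; lra. Qed.

(** A tube along the fiber of x, thin compared with its length r, so that near
    its end |xy| = r the direction towards x is almost tangent to the fibers. *)
Definition half_nbhs : set X :=
  [set y | mdist x y < r /\ `|F y - F x| < eps] `&` metric_cball p0 (mdist p0 x).

(** The upper bound is convexity, and the lower bound is the slope estimate. *)
Lemma coordinates_geo y t : mdist x y < r -> 0 <= t <= 1 ->
  C * `|(t *: F y + (1 - t) *: F x) - F (geo x y t)| <= (1 - t) * mdist x y / 4.
Proof.
have c1 := C1; move=> xy t01; have By := rB xy.
have -> : (1 - t) * mdist x y / 4 = C * ((1 - t) * (2 * (8 * C)^-1 * mdist x y)).
  by field; lra.
rewrite ler_pM2l; last lra.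
have e0 : 0 <= (1 - t) * (2 * (8 * C)^-1 * mdist x y).
  by rewrite !mulr_ge0// ?invr_ge0 ?mdist_ge0; lra.
apply: row_norm_le => // i; rewrite !mxE.
have s1 := slope i xy t01.
have := segment_convex HB (Bp i) Bx By (geoP HB Bx By) t01.
by rewrite ler_norml; lra.
Qed.

(** At time t the point of [x, y] is corrected to the affine interpolation of
    the coordinates of y and x, which its own coordinates approximate. *)
Definition contraction y t : X :=
  fixc ((1 - t) *: F y + t *: F x) (geo x y (clamp (1 - t))).

(** The push towards x gains 4 C |b - F y| |xy| / r in distance to x, which
    pays for the correction when y is close to the boundary of V. *)
Definition transport y b : X :=
  fixc b (geo x y (clamp (1 - 4 * C * `|b - F y| / r))).

Lemma geo_cball y t : mdist p0 y <= mdist p0 x -> B y -> 0 <= t <= 1 ->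
  mdist p0 (geo x y t) <= mdist p0 x.
Proof.
move=> p0y By t01.
apply: (le_trans (segment_convex HB Bp0 Bx By (geoP HB Bx By) t01)).
have : t * mdist p0 y <= t * mdist p0 x by rewrite ler_wpM2l//; lra.
by lra.
Qed.

Lemma contraction_spec y t : half_nbhs y -> 0 <= t <= 1 ->
  let z := geo x y (1 - t) in
  let b := (1 - t) *: F y + t *: F x in
  [/\ contraction y t = fixc b z, mdist x z + C * err p b z < rho &
      half_nbhs (fixc b z)].
Proof.
have c1 := C1; have r1 := r0; have rr := rrho.
move=> [[xy Fy] p0y] t01; have By := rB xy; rewrite /metric_cball/= in p0y.
have t01' : 0 <= 1 - t <= 1 by lra.
have := coordinates_geo xy t01'; rewrite subKr -/(err p _ _).
move=> /=; set z := geo x y (1 - t); set b := (1 - t) *: F y + t *: F x => ce.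
have xz : mdist x z = (1 - t) * mdist x y by have [] := mdist_geo HB Bx By t01'.
have d0 := mdist_ge0 x y.
have td : 0 <= t * mdist x y by rewrite mulr_ge0//; lra.
have zc : mdist x z + C * err p b z < rho by rewrite xz; lra.
have [h1 h2 h3] := fixP zc.
split => //; first by rewrite /contraction clamp_id.
split; last by apply: le_trans h3 (geo_cball _ _ _).
split; first by have := metric_triangle x z (fixc b z); rewrite xz; lra.
rewrite h1 (_ : b - F x = (1 - t) *: (F y - F x)); last first.
  by apply/rowP => i; rewrite !mxE; ring.
rewrite normrZ ger0_norm; last by lra.
by apply: le_lt_trans Fy; rewrite ler_piMl//; lra.
Qed.

(** With m the relative length of the push towards x, the resulting distance
    to x is at most |xy| + m (5r/16 - 3|xy|/4): a correction of cost
    C |b - F y| = m r / 4, a defect of cost m C eps = m r / 16 from F y differing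
    from F x, and the loss m |xy| / 4 of [coordinates_geo].  As m <= 1/2, this
    is less than r. *)
Lemma transport_spec y b : half_nbhs y -> `|b - F x| < eps ->
  let t := 1 - 4 * C * `|b - F y| / r in
  let z := geo x y t in
  [/\ 0 <= t <= 1, mdist x z + C * err p b z < rho & half_nbhs (transport y b)].
Proof.
have c1 := C1; have r1 := r0; have rr := rrho; have eE := epsE; have e0 := eps0.
move=> [[xy Fy] p0y] bx; have By := rB xy; rewrite /metric_cball/= in p0y.
set beta := `|b - F y|.
have beta0 : 0 <= beta by exact: normr_ge0.
have beta1 : beta < 2 * eps.
  have := ler_distD (F x) b (F y); rewrite (distrC (F x)) -/beta; lra.
have Cb : C * beta <= C * (2 * eps) by rewrite ler_wpM2l//; lra.
set m := 4 * C * beta / r.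
have mE : m * r = 4 * (C * beta) by rewrite /m divfK ?gt_eqF//; lra.
have m0 : 0 <= m by rewrite divr_ge0 ?mulr_ge0//; lra.
have m1 : m <= 1 / 2 by rewrite ler_pdivrMr//; lra.
have t01 : 0 <= 1 - m <= 1 by lra.
move=> /=; set z := geo x y (1 - m).
have xz : mdist x z = (1 - m) * mdist x y by have [] := mdist_geo HB Bx By t01.
have ce : C * err p b z <= C * beta + m * (C * eps) + m * mdist x y / 4.
  have := coordinates_geo xy t01; rewrite subKr -/z.
  set a := (1 - m) *: F y + m *: F x => ca.
  have h1 := ler_distD a b (F z).
  have h2 : `|b - a| <= beta + m * eps.
    rewrite (_ : b - a = (b - F y) + m *: (F y - F x)); last first.
      by apply/rowP => i; rewrite !mxE; ring.
    apply: le_trans (ler_normD _ _) _; rewrite normrZ (ger0_norm m0).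
    by rewrite lerD2l ler_wpM2l// ltW.
  have h3 : C * err p b z <= C * (`|b - a| + `|a - F z|).
    by rewrite ler_wpM2l//; lra.
  have h4 : C * `|b - a| <= C * (beta + m * eps) by rewrite ler_wpM2l//; lra.
  lra.
have d0 := mdist_ge0 x y.
have md : 0 <= m * mdist x y by rewrite mulr_ge0.
have mr : 0 <= m * r by rewrite mulr_ge0// ltW.
have mrle : m * r <= r / 2 by lra.
have mdle : m * mdist x y <= m * r by rewrite ler_wpM2l// ltW.
have meps : m * (C * eps) = m * r / 16 by rewrite -epsE; lra.
have zc : mdist x z + C * err p b z < rho by rewrite xz; lra.
have [h1 h2 h3] := fixP zc.
split => //.
rewrite /transport -/beta -/m clamp_id// -/z.
split; last by apply: le_trans h3 (geo_cball _ _ _).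
split; last by rewrite /= h1.
have key : 0 < (r - mdist x y) * (1 - 3 / 4 * m) by rewrite mulr_gt0//; lra.
by have := metric_triangle x z (fixc b z); rewrite /= xz; lra.
Qed.

Lemma half_nbhs_center : half_nbhs x.
Proof.
have r1 := r0; have e0 := eps0.
by split; [split; rewrite /= ?mdistxx ?subrr ?normr0|exact: lexx].
Qed.

Lemma err0 z : err p (F z) z = 0. Proof. by rewrite /err subrr normr0. Qed.

Lemma fix_id z : mdist x z < rho -> fixc (F z) z = z.
Proof.
move=> xz; have [|_ + _] := @fixP (F z) z; first by rewrite err0 mulr0 addr0.
rewrite err0 mulr0 => h; apply/esym/mdist_positivity/eqP.
by rewrite eq_le h mdist_ge0.
Qed.

Lemma half_nbhs_ball y : half_nbhs y -> [/\ mdist x y < r, mdist x y < rho & B y].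
Proof.
have r1 := r0; have rr := rrho.
by move=> [[xy _] _]; split => //; [lra|exact: rB].
Qed.

Lemma contraction0 y : half_nbhs y -> contraction y 0 = y.
Proof.
move=> Vy; have [xy xyr By] := half_nbhs_ball Vy.
rewrite /contraction subr0 scale1r scale0r addr0 clamp_id ?lexx ?ler01//.
by rewrite (geo1 HB)// fix_id.
Qed.

Lemma contraction1 y : half_nbhs y -> contraction y 1 = x.
Proof.
move=> Vy; have [xy _ By] := half_nbhs_ball Vy.
have [_ xr _] := half_nbhs_ball half_nbhs_center.
rewrite /contraction subrr scale0r scale1r add0r clamp_id ?lexx ?ler01//.
by rewrite (geo0 HB)// fix_id.
Qed.

Lemma transport_id y : half_nbhs y -> transport y (F y) = y.
Proof.
move=> Vy; have [xy xyr By] := half_nbhs_ball Vy.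
rewrite /transport subrr normr0 mulr0 mul0r subr0 clamp_id ?lexx ?ler01//.
by rewrite (geo1 HB)// fix_id.
Qed.

Lemma cvg_contraction (I : Type) (G : set_system I) (y_ : I -> X) (t_ : I -> R)
    (y : X) (t : R) : Filter G -> half_nbhs y -> 0 <= t <= 1 ->
  y_ @ G --> y -> t_ @ G --> t ->
  contraction (y_ i) (t_ i) @[i --> G] --> contraction y t.
Proof.
move=> FG Vy t01 yy tt; have [xy _ By] := half_nbhs_ball Vy.
have [_ h _] := contraction_spec Vy t01.
have tt1 : 1 - t_ i @[i --> G] --> 1 - t by apply: cvgB => //; exact: cvg_cst.
apply: fix_cvg.
- by rewrite clamp_id//; lra.
- apply: cvgD; apply: cvgZ => //; first exact: cvg_coordinates.
  exact: cvg_cst.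
- by apply: (cvg_geo HB) => //; exact: cvg_cst.
Qed.

Lemma cvg_transport (I : Type) (G : set_system I) (y_ : I -> X)
    (b_ : I -> 'rV[R]_k) (y : X) (b : 'rV[R]_k) :
  Filter G -> half_nbhs y -> `|b - F x| < eps ->
  y_ @ G --> y -> b_ @ G --> b ->
  transport (y_ i) (b_ i) @[i --> G] --> transport y b.
Proof.
move=> FG Vy bx yy bb; have [xy _ By] := half_nbhs_ball Vy.
have [t01 h _] := transport_spec Vy bx.
apply: fix_cvg => //; first by rewrite clamp_id.
apply: (cvg_geo HB) => //; first exact: cvg_cst.
apply: cvgB; first exact: cvg_cst.
apply: cvgM; last exact: cvg_cst.
apply: cvgM; first exact: cvg_cst.
by apply: cvg_norm; apply: cvgB => //; exact: cvg_coordinates.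
Qed.

Lemma half_nbhs_open : exists2 O : set X, open O &
  half_nbhs = O `&` metric_cball p0 (mdist p0 x).
Proof.
exists [set y | mdist x y < r /\ `|F y - F x| < eps] => //.
rewrite (_ : [set y | _] = mdist x @^-1` [set s : R | s < r] `&`
  (fun y => `|F y - F x|) @^-1` [set s : R | s < eps]).
  apply: openI; apply: open_comp; try exact: open_lt.
    by move=> y _; exact: mdist_continuous.
  move=> y _; apply: cvg_norm; apply: cvgB; last exact: cvg_cst.
  exact: cvg_coordinates.
by apply/seteqP; split => y.
Qed.

Lemma half_nbhs_fibration (f : X -> 'rV[R]_k) :
  (forall y, half_nbhs y -> f y = F y) ->
  contractible R (set_type half_nbhs) /\
  hurewicz_fibration R (@onto_image _ _ f half_nbhs) /\
  forall w : 'rV[R]_k, (f @` half_nbhs) w ->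
    contractible R (set_type (half_nbhs `&` f @^-1` [set w])).
Proof.
move=> fF.
have hV y t : half_nbhs y -> 0 <= t <= 1 -> half_nbhs (contraction y t).
  by move=> Vy t01; have [-> _] := contraction_spec Vy t01.
have fV b : (f @` half_nbhs) b -> `|b - F x| < eps.
  by move=> [y Vy <-]; rewrite fF//; case: Vy => -[].
have tauV y b : half_nbhs y -> (f @` half_nbhs) b ->
    half_nbhs (transport y b) /\ f (transport y b) = b.
  move=> Vy /fV bx; have [t01 h Vt] := transport_spec Vy bx; split=> //.
  by rewrite fF// /transport clamp_id//; have [-> _ _] := fixP h.
have tid y : half_nbhs y -> transport y (f y) = y.
  by move=> Vy; rewrite fF// transport_id.
have fc y : half_nbhs y -> f @ within half_nbhs (nbhs y) --> f y.
  move=> Vy; rewrite fF//.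
  apply: (@cvg_trans _ (F @ within half_nbhs (nbhs y))).
    by apply: near_eq_cvg; near=> y'; rewrite fF//; near: y'; exact: withinT.
  by apply: cvg_within_filter; exact: cvg_coordinates.
have tcvg (I : Type) (G : set_system I) (y_ : I -> X) (b_ : I -> 'rV[R]_k)
    (y : X) (b : 'rV[R]_k) :
  Filter G -> half_nbhs y -> (f @` half_nbhs) b -> y_ @ G --> y -> b_ @ G --> b ->
  transport (y_ i) (b_ i) @[i --> G] --> transport y b.
  by move=> FG Vy /fV; exact: cvg_transport.
split.
  exact: (contractible_set half_nbhs_center hV cvg_contraction
    contraction0 contraction1).
split.
  by apply: (@transport_hurewicz R X _ half_nbhs f transport fc tauV tid tcvg).
move=> w; exact: (transport_fiber tauV tid tcvg half_nbhs_center hV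
  cvg_contraction contraction0 contraction1).
Unshelve. all: by end_near. Qed.

End neighborhood.

Theorem theorem6p8 (R : realType) (k : nat) (hk : (1 <= k)%N) :
  exists2 delta_k : R, 0 < delta_k &
    forall (X : metricType R) (delta : R) (x p0 : X) (r : R)
      (f : X -> 'rV[R]_k),
    gnpc X -> 0 < delta < delta_k ->
    half_strainer_map delta x p0 r f -> metric_sphere p0 r x ->
    forall N : set X, within (metric_cball p0 r) (nbhs x) N ->
    exists V : set X,
      [/\ V x, V `<=` N,
          exists2 O : set X, open O & V = O `&` metric_cball p0 r,
          contractible R (set_type V) &
          hurewicz_fibration R (@onto_image _ _ f V) /\
          forall w, (f @` V) w -> contractible R (set_type (V `&` f @^-1` [set w]))].
Proof.
(* One sweep multiplies the error by at most theta * 2 ^+ k, and the iteration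
   adds at most 4 * (theta * 2 ^+ k) times the initial error to d_0, which the
   move towards p_0 has lowered by the initial error. *)
pose theta : R := (4 * 2 ^+ k)^-1.
have pow0 : 0 < (2 ^+ k : R) by rewrite exprn_gt0.
have theta0 : 0 < theta by rewrite invr_gt0 mulr_gt0.
have theta_small : 4 * (theta * 2 ^+ k) <= 1.
  by rewrite /theta le_eqVlt; apply/orP; left; apply/eqP; field; rewrite gt_eqF.
have [dk dk0 small] := small_angle theta0.
exists dk => // X delta x p0 rx f [_ _ lgc _] /andP[d0 dlt].
move=> [B [p [tB Bx ext -> fE]]] _ N Nx.
have small' (a : R) : `|a| < delta -> 1 - theta <= cos a /\ `|sin a| <= theta.
  by move=> ad; apply: small; exact: lt_trans dlt.
have HB := tiny_ball_region tB.
have [pbar [rho rho0 fr]] := strainer_frame HB Bx small' ext.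
have [c [q [q0 BE cptK [cK _ _]]]] := tB.
have BK : B `<=` metric_cball c (10 * q).
  by rewrite BE ballEmdist => y /=; rewrite /metric_cball/=; lra.
have oB : open B.
  rewrite BE ballEmdist (_ : [set y | _] = mdist c @^-1` [set s : R | s < q])//.
  by apply: open_comp; [move=> y _; exact: mdist_continuous|exact: open_lt].
have /metricType_numDomainType.nbhs_mdistP[d /= d1 dB] : nbhs x B.
  exact: open_nbhs_nbhs.
have /metricType_numDomainType.nbhs_mdistP[n /= n0 nN] : nbhs x
  [set y | metric_cball p0 (mdist p0 x) y -> N y] by exact: Nx.
have dB' w : mdist x w <= d / 2 -> B w by move=> xw; apply: dB => /=; lra.
have cpt : compact (metric_cball x (d / 2)).
  apply: (subclosed_compact _ cptK); first exact: closed_cball.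
  by move=> w /dB' /BK.
have C1 : 1 <= correction_factor R k by rewrite /correction_factor; lra.
have eta0 : 0 < (8 * correction_factor R k)^-1 by rewrite invr_gt0; lra.
have d20 : 0 < d / 2 by lra.
have xp i : x <> p i.
  have [|_ _ /(_ i)[]//] := frame_ball fr (z := x).
  by rewrite mdistxx; lra.
(* Over the finitely many i, the scales at which d_i is almost affine have a
   common lower bound. *)
have : \forall s \near (0:R)^'+, forall i y t, mdist x y < s -> 0 <= t <= 1 ->
    mdist (p i) y - mdist (p i) (geo x y t) <=
    (1 - t) * (mdist (p i) y - mdist (p i) x +
      2 * (8 * correction_factor R k)^-1 * mdist x y).
  apply: filter_forall => i.
  have [r' r'0 hr'] := uniform_slope HB lgc oB Bx (frame_p fr i) (xp i)
    d20 eta0 dB' cpt.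
  near=> s => y t xys t01; apply: hr' => //; apply: (le_trans (ltW xys)).
  by near: s; exact: nbhs_right_le.
move=> slope.
have [r [r0 rrho rd rn rslope]] :
    exists r, [/\ 0 < r, 4 * r <= rho, r <= d, r <= n &
    forall i y t, mdist x y < r -> 0 <= t <= 1 ->
    mdist (p i) y - mdist (p i) (geo x y t) <=
    (1 - t) * (mdist (p i) y - mdist (p i) x +
      2 * (8 * correction_factor R k)^-1 * mdist x y)].
  near (0:R)^'+ => s; exists s; split.
  - by near: s; exact: nbhs_right_gt.
  - have : s <= rho / 4 by near: s; apply: nbhs_right_le; lra.
    by lra.
  - by near: s; exact: nbhs_right_le.
  - by near: s; exact: nbhs_right_le.
  - by near: s.
have rB y : mdist x y < r -> B y by move=> xy; apply: dB => /=; lra.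
have fixP := correctP HB cK BK fr rho0 (ltW theta0) theta_small.
have fixc := cvg_correct HB oB cK BK fr rho0 (ltW theta0) theta_small.
exists (half_nbhs x p0 p (correction_factor R k) r).
have [h1 [h2 h3]] := half_nbhs_fibration HB oB Bx (frame_p0 fr) (frame_p fr)
  C1 r0 rrho rB (fun b z => @fixP b z) fixc rslope (f := f)
  (fun y Vy => fE y (mem_set Vy.2)).
split=> //.
- exact: half_nbhs_center.
- by move=> y [[xy _] yp0]; apply: nN => //=; lra.
- exact: half_nbhs_open.
Unshelve. all: by end_near. Qed.
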